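(* a) Let $0<p<1/2$, $f\in H_p$, and let $\{q_k:k\ge0\}$ be a non-increasing sequence of non-negative numbers with $q_0>0$. Then there exists an absolute constant $c_p$, depending only on $p$, such that $$\sum_{k=1}^{\infty}\frac{\|T_kf\|_p^p}{k^{2-2p}}\le c_p\|f\|_{H_p}^p .$$ b) Let $f\in H_{1/2}$ and let $\{q_k:k\ge0\}$ be a non-increasing sequence of non-negative numbers with $q_0>0$, satisfying $$\frac1{Q_n}=O\left(\frac1n\right)\quad\text{as } n\to\infty .$$ Then there exists an absolute constant $c$ such that, for all integers $n\ge 2$, $$\frac1{\log n}\sum_{k=1}^{n}\frac{\|T_kf\|_{1/2}^{1/2}}{k}\le c\,\|f\|_{H_{1/2}}^{1/2}.$$
   Context: $\mathbb N_+$ is the set of positive integers and $\mathbb N=\mathbb N_+\cup\{0\}$. Let $m=(m_0,m_1,\dots)$ be a sequence of integers $m_k\ge 2$ with $\sup_k m_k<\infty$, and let $Z_{m_k}=\{0,\dots,m_k-1\}$ be the additive group of integers modulo $m_k$ with the discrete topology. $G_m=\prod_k Z_{m_k}$ is the (bounded) Vilenkin group with the product topology, and $\mu$ is its Haar measure with $\mu(G_m)=1$ (the product of the uniform measures). Put $M_0=1$, $M_{k+1}=m_kM_k$; every $n\in\mathbb N$ is uniquely $n=\sum_{j\ge0}n_jM_j$ with $n_j\in Z_{m_j}$. For $x\in G_m$ let $I_0(x)=G_m$, $I_n(x)=\{y\in G_m: y_0=x_0,\dots,y_{n-1}=x_{n-1}\}$. Generalized Rademacher functions: $r_k(x)=\exp(2\pi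 i x_k/m_k)$; Vilenkin system: $\psi_n(x)=\prod_{k\ge 0} r_k(x)^{n_k}$. $\|f\|_p^p=\int_{G_m}|f|^p\,d\mu$. A martingale $f=(f^{(n)},n\in\mathbb N)$ is taken with respect to the $\sigma$-algebras $\digamma_n$ generated by $\{I_n(x):x\in G_m\}$; its maximal function is $f^*=\sup_n|f^{(n)}|$, and $H_p$ ($0<p<\infty$) consists of all martingales with $\|f\|_{H_p}:=\|f^*\|_p<\infty$. Vilenkin–Fourier coefficients of a martingale: $\widehat f(i)=\lim_{k\to\infty}\int_{G_m}f^{(k)}\overline{\psi_i}\,d\mu$. Partial sums: $S_nf=\sum_{k=0}^{n-1}\widehat f(k)\psi_k$ (so $S_0f=0$). The $T$ means generated by $\{q_k\}$: $T_nf=\frac1{Q_n}\sum_{k=0}^{n-1}q_kS_kf$ with $Q_n=\sum_{k=0}^{n-1}q_k$, $n\in\mathbb N_+$.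
   Formalization: In b) the constant c may depend on q_0 and on the constant implied in 1/Q_n = O(1/n), but not otherwise on the sequence q_k, on f or on n; a constant independent of these is impossible, as q_k = 1 for k < K and q_k = ε afterwards shows. *)

(* Defs.v *)
From HB Require Import structures.
From mathcomp Require Import all_boot all_order all_algebra.
From mathcomp Require Import all_classical all_reals all_analysis.
From mathcomp Require Import complex.

Set Implicit Arguments.
Unset Strict Implicit.
Unset Printing Implicit Defensive.
Import Order.TTheory GRing.Theory Num.Theory.
Import numFieldNormedType.Exports.

Local Open Scope classical_set_scope.
Local Open Scope ring_scope.
Local Open Scope complex_scope.

Local Notation "z ^*" := (conjc z) : complex_scope.

(* The points of the Vilenkin group, with the product of the discrete
   topologies. 'Z_n is the integers modulo n only for n >= 2, which is assumed
   of every m k wherever these definitions are used. *)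
Definition vilenkin_space (m : nat -> nat) : Type :=
  prod_topology (fun k => discrete_topology 'Z_(m k)).

HB.instance Definition _ (m : nat -> nat) := Topological.on (vilenkin_space m).
HB.instance Definition _ (m : nat -> nat) :=
  isPointed.Build (vilenkin_space m) (fun k => 0).

(* The same points, carrying the Borel sigma-algebra of that topology. *)
Definition vilenkin (m : nat -> nat) : Type :=
  g_sigma_algebraType (@open (vilenkin_space m)).

HB.instance Definition _ (m : nat -> nat) := Measurable.on (vilenkin m).

Definition coordinate (m : nat -> nat) (x : vilenkin m) (k : nat) : 'Z_(m k) :=
  x k.

Definition vilenkin_add (m : nat -> nat) (x y : vilenkin m) : vilenkin m :=
  fun k => coordinate x k + coordinate y k.

(* On this compact metrizable group, a Borel probability measure is the
   normalized Haar measure exactly when it is translation invariant. *)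
Definition is_haar (R : realType) (m : nat -> nat)
    (mu : probability (vilenkin m) R) : Prop :=
  forall (a : vilenkin m) (A : set (vilenkin m)),
    measurable A -> mu (vilenkin_add a @` A) = mu A.

Definition gen_power (m : nat -> nat) (k : nat) : nat := (\prod_(j < k) m j)%N.

(* n_j in the expansion n = \sum_j n_j M_j with 0 <= n_j < m_j. *)
Definition digit (m : nat -> nat) (n j : nat) : nat :=
  ((n %/ gen_power m j) %% m j)%N.

Definition cylinder (m : nat -> nat) (n : nat) (x : vilenkin m) :
    set (vilenkin m) :=
  [set y | forall k, (k < n)%N -> coordinate y k = coordinate x k].

Definition filtration (m : nat -> nat) (n : nat) : set (set (vilenkin m)) :=
  <<s [set cylinder n x | x in [set: vilenkin m]] >>.

Definition rademacher (R : realType) (m : nat -> nat) (k : nat)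
    (x : vilenkin m) : R[i] :=
  let t : R := 2 * pi * (coordinate x k)%:R / (m k)%:R in cos t +i* sin t.

(* When all m j >= 2 we have M_k >= 2 ^ k > n for k >= n, so that n_k = 0 and
   the factors with k >= n of the infinite product are all 1. *)
Definition psi (R : realType) (m : nat -> nat) (n : nat) (x : vilenkin m) :
    R[i] :=
  \prod_(k < n) rademacher R k x ^+ digit m n k.

Section martingales.
Context (R : realType) (m : nat -> nat).
Variable mu : probability (vilenkin m) R.

Definition cintegrable (g : vilenkin m -> R[i]) : Prop :=
  mu.-integrable setT (fun x => (complex.Re (g x))%:E) /\
  mu.-integrable setT (fun x => (complex.Im (g x))%:E).

Definition cintegral (D : set (vilenkin m)) (g : vilenkin m -> R[i]) : R[i] :=
  (\int[mu]_(x in D) complex.Re (g x)) +i* (\int[mu]_(x in D) complex.Im (g x)).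

Definition adapted_at (n : nat) (g : vilenkin m -> R[i]) : Prop :=
  forall B : set R, measurable B ->
    filtration n ((fun x => complex.Re (g x)) @^-1` B) /\
    filtration n ((fun x => complex.Im (g x)) @^-1` B).

(* The last clause says that f n is the conditional expectation of f n.+1
   given the sigma-algebra filtration n. *)
Definition martingale (f : nat -> vilenkin m -> R[i]) : Prop :=
  forall n, [/\ adapted_at n (f n), cintegrable (f n) &
    forall A, filtration n A -> cintegral A (f n.+1) = cintegral A (f n)].

Local Open Scope ereal_scope.

Definition maximal (f : nat -> vilenkin m -> R[i]) (x : vilenkin m) : \bar R :=
  ereal_sup (range (fun n => (Normc.normc (f n x))%:E)).

Definition hardy_norm (p : R) (f : nat -> vilenkin m -> R[i]) : \bar R :=
  'N[mu]_p%:E[maximal f].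

Definition hardy (p : R) : set (nat -> vilenkin m -> R[i]) :=
  [set f | martingale f /\ hardy_norm p f < +oo].

Definition cLnorm (p : R) (g : vilenkin m -> R[i]) : \bar R :=
  'N[mu]_p%:E[(fun x => (Normc.normc (g x))%:E)].

Local Close Scope ereal_scope.

Definition fourier_coef (f : nat -> vilenkin m -> R[i]) (i : nat) : R[i] :=
  lim ((fun k => cintegral setT (fun x => f k x * (psi R i x)^*) : (R[i])^o)
         @ \oo).

Definition partial_sum (n : nat) (f : nat -> vilenkin m -> R[i])
    (x : vilenkin m) : R[i] :=
  \sum_(k < n) fourier_coef f k * psi R k x.

Definition weight_sum (q : nat -> R) (n : nat) : R := \sum_(k < n) q k.

Definition T_mean (q : nat -> R) (n : nat) (f : nat -> vilenkin m -> R[i])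
    (x : vilenkin m) : R[i] :=
  ((weight_sum q n)^-1)%:C * \sum_(k < n) (q k)%:C * partial_sum k f x.

End martingales.

(* Main.v *)
(** No atomic decomposition is used.  If n <= M_L, the sum of the
    first n partial sums S_k f is the convolution of the level-L function f^(L)
    with the kernel sum_(k < n) D_k, which is dominated by
    c sum_(A < L) sum_(t <= A) M_t M_A 1{z_j = 0 for j < A, j <> t}.
    Hence it is bounded pointwise by kernel_op, a sum over A and t of M_t times
    translates of the conditional expectations E_A g_L, where
    g_L = max_(j <= L) |f^(j)| and E_A averages over the coordinates A, ..., L-1.
    Write g_L^p as the sum of the nonnegative increments v_j of the running
    maximum of |f^(j)|^p.  Minkowski's inequality in l^(1/p) and the
    subadditivity of t^p give
      E (E_A g_L)^p <= sum_(j <= L) max(1, M_j / M_A)^(1 - p) E v_j,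
    and the E v_j add up to at most the p-th power of the Hardy norm.
    Summing geometric series over the levels yields
    sum_(B < K) M_B^(p - 1) E (kernel_op at level B + 1)^p
      <= c (sum_(A <= K) M_A^(2 p - 1)) ||f||^p.
    The last sum is bounded if p < 1/2 and equals K + 1 if p = 1/2, which is
    where the logarithm comes from.  Abel summation transfers the bounds to the
    T means. *)
Require Import Defs.
From mathcomp Require Import all_boot all_order all_algebra.
From mathcomp Require Import all_classical all_reals all_analysis.
From mathcomp Require Import measurable_realfun complex ring lra zify.
Set Implicit Arguments.
Unset Strict Implicit.
Unset Printing Implicit Defensive.
Import Order.TTheory GRing.Theory Num.Theory.
Import numFieldNormedType.Exports.
Local Open Scope classical_set_scope.
Local Open Scope ring_scope.

(** * Real inequalities *)

Section RealInequalities.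
Context {R : realType}.
Implicit Types (p : R) (a : nat -> R).

(** With s = x + y, each of x/s and y/s lies in [0, 1], so it is at most its own p-th power;
    multiplying by s^p and adding gives the bound. *)
Lemma powR_le_add p x y : 0 < p -> p <= 1 -> 0 <= x -> 0 <= y ->
  (x + y) `^ p <= x `^ p + y `^ p.
Proof.
move=> p0 p1 x0 y0.
have [s0|s0] := eqVneq (x + y) 0.
  by rewrite s0 powR0 ?gt_eqF// addr_ge0 ?powR_ge0.
have sgt : 0 < x + y by rewrite lt_def s0 addr_ge0.
have H z : 0 <= z -> z <= x + y -> z / (x + y) * (x + y) `^ p <= z `^ p.
  move=> z0 zs; have [->|zn0] := eqVneq z 0.
    by rewrite !mul0r powR_ge0.
  have zgt : 0 < z by rewrite lt_def zn0.
  rewrite -[X in _ <= X `^ p](divfK s0 z) powRM ?divr_ge0 ?(ltW sgt)//.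
  rewrite ler_wpM2r ?powR_ge0// ger1_powR//.
  by rewrite divr_gt0//= ler_pdivrMr ?mul1r.
have -> : (x + y) `^ p = x / (x + y) * (x + y) `^ p + y / (x + y) * (x + y) `^ p.
  by rewrite -mulrDl -mulrDl divff ?mul1r.
by rewrite lerD// H// ?lerDl ?lerDr.
Qed.

Lemma powR_le_sum (I : Type) (s : seq I) (P : pred I) (F : I -> R) p :
  0 < p -> p <= 1 -> (forall i, 0 <= F i) ->
  (\sum_(i <- s | P i) F i) `^ p <= \sum_(i <- s | P i) F i `^ p.
Proof.
move=> p0 p1 F0; elim: s => [|i s IH]; first by rewrite !big_nil powR0 ?gt_eqF.
rewrite !big_cons; case: (P i) => //.
by rewrite (le_trans (powR_le_add _ _ _ _))// ?lerD2l// sumr_ge0.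
Qed.

Lemma powRVK p x : p != 0 -> 0 <= x -> (x `^ p^-1) `^ p = x.
Proof. by move=> p0 x0; rewrite -powRrM mulVf// powRr1. Qed.

Lemma powRKV p x : p != 0 -> 0 <= x -> (x `^ p) `^ p^-1 = x.
Proof. by move=> p0 x0; rewrite -powRrM mulfV// powRr1. Qed.

Lemma ler_powR_base p x y : 0 <= p -> 0 <= x -> x <= y -> x `^ p <= y `^ p.
Proof.
by move=> p0 x0 xy; apply: ge0_ler_powR; rewrite // nnegrE// (le_trans x0).
Qed.

(** Minkowski's inequality in l^(1/p). With A and B the norms of u and v, (u + v)/(A + B) is a
    convex combination of u/A and v/B, and t^(1/p) is convex. A zero norm is treated apart: it
    forces the family to vanish. *)
Lemma minkowski_sum (I : finType) (u v : I -> R) p : 0 < p -> p <= 1 ->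
  (forall i, 0 <= u i) -> (forall i, 0 <= v i) ->
  (\sum_i (u i + v i) `^ p^-1) `^ p <=
  (\sum_i u i `^ p^-1) `^ p + (\sum_i v i `^ p^-1) `^ p.
Proof.
move=> p0 p1 u0 v0; set A := (\sum_i u i `^ p^-1) `^ p; set B := (\sum_i v i `^ p^-1) `^ p.
have pn0 : p != 0 by rewrite gt_eqF.
have Sge (w : I -> R) : 0 <= \sum_i w i `^ p^-1.
  by rewrite sumr_ge0// => i _; rewrite powR_ge0.
have zero (w : I -> R) : (forall i, 0 <= w i) ->
    (\sum_i w i `^ p^-1) `^ p = 0 -> forall i, w i = 0.
  move=> w0 /powR_eq0_eq0/eqP; rewrite psumr_eq0 => [|i _]; last exact: powR_ge0.
  by move=> /allP h i; have := h i (mem_index_enum _) => /= /eqP/powR_eq0_eq0.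
have [A0|An0] := eqVneq A 0.
  rewrite A0 add0r; under eq_bigr do rewrite (zero u u0 A0) add0r; exact: lexx.
have [B0|Bn0] := eqVneq B 0.
  rewrite B0 addr0; under eq_bigr do rewrite (zero v v0 B0) addr0; exact: lexx.
have AE : A `^ p^-1 = \sum_i u i `^ p^-1 by rewrite /A powRKV.
have BE : B `^ p^-1 = \sum_i v i `^ p^-1 by rewrite /B powRKV.
have Agt : 0 < A by rewrite lt_def An0 powR_ge0.
have Bgt : 0 < B by rewrite lt_def Bn0 powR_ge0.
clearbody A B.
have ABgt : 0 < A + B by rewrite addr_gt0.
have p'1 : 1 <= p^-1 by rewrite invf_ge1.
have t01 : 0 <= A / (A + B) <= 1.
  by rewrite divr_ge0 ?(ltW Agt) ?(ltW ABgt)//= ler_pdivrMr// mul1r lerDl ltW.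
pose t := Itv01 (andP t01).1 (andP t01).2.
have key i : (u i + v i) `^ p^-1 <= (A + B) `^ p^-1 *
   (A / (A + B) * (u i `^ p^-1 / A `^ p^-1) + B / (A + B) * (v i `^ p^-1 / B `^ p^-1)).
  have -> : u i + v i = (A + B) * (A / (A + B) * (u i / A) + B / (A + B) * (v i / B)).
    by field; rewrite An0 Bn0 gt_eqF.
  have tB : 1 - A / (A + B) = B / (A + B) by field; rewrite gt_eqF.
  have pos : 0 <= A / (A + B) * (u i / A) + B / (A + B) * (v i / B).
    by rewrite addr_ge0// mulr_ge0 ?divr_ge0// ltW.
  rewrite powRM ?(ltW ABgt)// ler_wpM2l ?powR_ge0//.
  have := @convex_powR R _ p'1 t (u i / A) (v i / B).
  rewrite convRE [X in X `^ _ <= _]convRE /= /unstable.onem tB => h.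
  have aux (z c : R) : 0 <= z -> 0 < c -> (z / c) `^ p^-1 = z `^ p^-1 / c `^ p^-1.
    move=> z0 c0; rewrite powRM ?invr_ge0 ?(ltW c0)//.
    by rewrite -(powR_inv1 (ltW c0)) -powRrM mulN1r powRN.
  rewrite -!aux//; apply: h; rewrite inE /= in_itv /= andbT divr_ge0//.
    exact: ltW.
  exact: ltW.
apply: (@le_trans _ _ (((A + B) `^ p^-1) `^ p)); last by rewrite powRVK// ltW.
apply: ler_powR_base; [exact: ltW|exact: Sge|].
apply: (le_trans (ler_sum _ (fun i _ => key i))).
rewrite -mulr_sumr big_split/= -!mulr_sumr -!mulr_suml.
rewrite -AE -BE !divff ?gt_eqF ?powR_gt0// !mulr1 -mulrDl divff ?gt_eqF//.
by rewrite mulr1.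
Qed.

(** The constant c = 1/(1 - th) reproduces itself in the induction: c a_n <= c th a_(n+1) = (c - 1)
    a_(n+1). *)
Lemma geometric_sum_last (th : R) a (n : nat) : 0 <= th -> th < 1 ->
  (forall k, 0 <= a k) -> (forall k, a k <= th * a k.+1) ->
  \sum_(k < n.+1) a k <= (1 - th)^-1 * a n.
Proof.
move=> th0 th1 a0 ha; elim: n => [|n IH].
  rewrite big_ord_recr big_ord0 /= add0r ler_peMl// invf_ge1 ?subr_gt0//.
  by rewrite gerBl.
rewrite big_ord_recr /= (le_trans (lerD IH (lexx _)))//.
rewrite -lerBrDr -{2}(mul1r (a n.+1)) -mulrBl.
have -> : (1 - th)^-1 - 1 = (1 - th)^-1 * th.
  by field; rewrite gt_eqF// subr_gt0.
by rewrite -mulrA ler_wpM2l ?invr_ge0 ?subr_ge0 ?(ltW th1).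
Qed.

Lemma geometric_sum_first (th : R) a (m n : nat) : 0 <= th -> th < 1 ->
  (forall k, 0 <= a k) -> (forall k, a k.+1 <= th * a k) ->
  \sum_(m <= k < n) a k <= (1 - th)^-1 * a m.
Proof.
move=> th0 th1 a0 ha.
have [mn|nm] := leqP n m.
  by rewrite big_geq// mulr_ge0 ?invr_ge0 ?subr_ge0 ?(ltW th1).
rewrite -(subnKC (ltnW nm)); move: (n - m)%N => d; elim: d m {nm} => [|d IH] m.
  by rewrite addn0 big_geq// mulr_ge0 ?invr_ge0 ?subr_ge0 ?(ltW th1).
rewrite big_ltn; last by rewrite addnS ltnS leq_addr.
rewrite addnS -addSn (le_trans (lerD (lexx _) (IH _)))//.
rewrite -lerBrDl -{2}(mul1r (a m)) -mulrBl.
have -> : (1 - th)^-1 - 1 = (1 - th)^-1 * th.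
  by field; rewrite gt_eqF// subr_gt0.
by rewrite -mulrA ler_wpM2l ?invr_ge0 ?subr_ge0 ?(ltW th1).
Qed.

(** Summation by parts. For non-increasing nonnegative [q] the coefficients on the right are
    nonnegative, so bounds on the sums of [s] pass to weighted sums. *)
Lemma sum_abel (V : comPzRingType) (q s : nat -> V) n :
  \sum_(k < n.+1) q k * s k =
  \sum_(k < n) (q k - q k.+1) * \sum_(j < k.+1) s j + q n * \sum_(j < n.+1) s j.
Proof.
elim: n => [|n IH]; first by rewrite big_ord0 add0r !big_ord1.
rewrite big_ord_recr /= IH [in RHS]big_ord_recr /= [X in _ = _ + q n.+1 * X]big_ord_recr /=.
ring.
Qed.

End RealInequalities.

(** * Averages over coordinates *)

Section Averages.
Context {m : nat -> nat}.
Hypothesis m_ge2 : forall k, (2 <= m k)%N.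
Local Notation X := (vilenkin m).
Local Notation M := (gen_power m).

Lemma gen_power0 : M 0 = 1%N. Proof. by rewrite /gen_power big_ord0. Qed.

Lemma gen_powerS k : M k.+1 = (M k * m k)%N.
Proof. by rewrite /gen_power big_ord_recr. Qed.

Lemma gen_power_gt0 k : (0 < M k)%N.
Proof.
elim: k => [|k IH]; first by rewrite gen_power0.
by rewrite gen_powerS muln_gt0 IH (leq_trans _ (m_ge2 k)).
Qed.

Lemma gen_power_double k : (2 * M k <= M k.+1)%N.
Proof. by rewrite gen_powerS mulnC leq_mul2l m_ge2 orbT. Qed.

Lemma leq_gen_power j k : (j <= k)%N -> (M j <= M k)%N.
Proof.
elim: k => [|k IH]; first by rewrite leqn0 => /eqP ->.
rewrite leq_eqVlt => /predU1P[->//|]; rewrite ltnS => /IH h.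
by rewrite (leq_trans h)// (leq_trans _ (gen_power_double k))// leq_pmull.
Qed.

Lemma exp2_le_gen_power k : (2 ^ k <= M k)%N.
Proof.
elim: k => [|k IH]; first by rewrite gen_power0.
by rewrite expnS (leq_trans _ (gen_power_double k))// leq_mul2l IH orbT.
Qed.

Lemma ltn_gen_power k : (k < M k)%N.
Proof. by rewrite (leq_trans (ltn_expl k (ltnSn 1)))// exp2_le_gen_power. Qed.

Lemma card_coordinate k : #|'Z_(m k)| = m k.
Proof. by rewrite card_ord Zp_cast. Qed.

Lemma vilenkin_ext (x y : X) :
  (forall k, coordinate x k = coordinate y k) -> x = y.
Proof. by move=> h; apply: functional_extensionality_dep. Qed.

Definition upd (x : X) (k : nat) (s : 'Z_(m k)) : X :=
  @dfwith nat (fun j => 'Z_(m j)) x k s.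

Lemma upd_in x k (s : 'Z_(m k)) : coordinate (upd x s) k = s.
Proof. by rewrite /coordinate /upd dfwithin. Qed.

Lemma upd_out x k (s : 'Z_(m k)) j : k != j ->
  coordinate (upd x s) j = coordinate x j.
Proof. by move=> kj; rewrite /coordinate /upd dfwithout. Qed.

Lemma upd_upd x k (s s' : 'Z_(m k)) : upd (upd x s) s' = upd x s'.
Proof.
apply: vilenkin_ext => j; have [<-|kj] := eqVneq k j; first by rewrite !upd_in.
by rewrite !upd_out.
Qed.

Lemma updC x k l (s : 'Z_(m k)) (t : 'Z_(m l)) : k != l ->
  upd (upd x s) t = upd (upd x t) s.
Proof.
move=> kl; apply: vilenkin_ext => j.
have [<-|kj] := eqVneq k j; first by rewrite upd_in upd_out 1?eq_sym// upd_in.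
have [<-|lj] := eqVneq l j; first by rewrite upd_in upd_out// upd_in.
by rewrite !upd_out.
Qed.

Lemma upd_id x k : upd x (coordinate x k) = x.
Proof.
apply: vilenkin_ext => j; have [<-|kj] := eqVneq k j; first by rewrite upd_in.
by rewrite upd_out.
Qed.

(** Measurability with respect to [filtration n], expressed through coordinates so that integrals
    become finite averages. *)
Definition level (T : Type) (n : nat) (phi : X -> T) : Prop :=
  forall x y, (forall k, (k < n)%N -> coordinate x k = coordinate y k) ->
  phi x = phi y.

Lemma level_widen T n k (phi : X -> T) : (n <= k)%N -> level n phi -> level k phi.
Proof. by move=> nk h x y xy; apply: h => j jn; apply: xy; apply: leq_trans nk. Qed.

Lemma level_upd T n k (phi : X -> T) x (s : 'Z_(m k)) : level n phi -> (n <= k)%N ->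
  phi (upd x s) = phi x.
Proof. by move=> h nk; apply: h => j jn; rewrite upd_out// gtn_eqF// (leq_trans jn). Qed.

Lemma level_comp T U n (phi : X -> T) (g : T -> U) : level n phi -> level n (fun x => g (phi x)).
Proof. by move=> h x y /h ->. Qed.

Lemma level_comp2 T U V n (phi : X -> T) (psi : X -> U) (g : T -> U -> V) :
  level n phi -> level n psi -> level n (fun x => g (phi x) (psi x)).
Proof. by move=> h h' x y xy; rewrite (h x y xy) (h' x y xy). Qed.

Lemma level_sum (V : nmodType) (I : Type) (r : seq I) (P : pred I) n (F : I -> X -> V) :
  (forall i, P i -> level n (F i)) -> level n (fun x => \sum_(i <- r | P i) F i x).
Proof. by move=> h x y xy; apply: eq_bigr => i Pi; apply: (h i Pi). Qed.

Section CoordinateAverages.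
Context {K : numFieldType}.
Implicit Types phi psi : X -> K.

(** On functions of finitely many coordinates, this is the conditional expectation given all
    coordinates but the k-th. *)
Definition avg (k : nat) phi : X -> K :=
  fun x => (m k)%:R^-1 * \sum_(s : 'Z_(m k)) phi (upd x s).

Lemma modulus_neq0 k : (m k)%:R != 0 :> K.
Proof. by rewrite pnatr_eq0 -lt0n (leq_trans _ (m_ge2 k)). Qed.

Lemma sum_upd k phi x : \sum_(s : 'Z_(m k)) phi (upd x s) = (m k)%:R * avg k phi x.
Proof. by rewrite /avg mulrA divff ?modulus_neq0// mul1r. Qed.

Lemma avgD k phi psi : avg k (fun x => phi x + psi x) = (fun x => avg k phi x + avg k psi x).
Proof. by apply/funext => x; rewrite /avg big_split mulrDr. Qed.

Lemma avg_ge0 k phi : (forall x, 0 <= phi x) -> forall x, 0 <= avg k phi x.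
Proof. by move=> h x; rewrite mulr_ge0 ?invr_ge0// sumr_ge0. Qed.

Lemma avg_le k phi psi : (forall x, phi x <= psi x) -> forall x, avg k phi x <= avg k psi x.
Proof. by move=> h x; rewrite /avg ler_wpM2l ?invr_ge0// ler_sum. Qed.

Lemma avgM k psi phi : (forall x (s : 'Z_(m k)), psi (upd x s) = psi x) ->
  avg k (fun x => psi x * phi x) = (fun x => psi x * avg k phi x).
Proof.
move=> h; apply/funext => x; rewrite /avg; under eq_bigr do rewrite h.
by rewrite -mulr_sumr mulrCA.
Qed.

Lemma avg_indep k psi : (forall x (s : 'Z_(m k)), psi (upd x s) = psi x) ->
  avg k psi = psi.
Proof.
move=> h; apply/funext => x; rewrite /avg; under eq_bigr do rewrite h.
by rewrite sumr_const card_coordinate -[X in _ * X]mulr_natl mulrA mulVf ?modulus_neq0 ?mul1r.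
Qed.

Lemma avg_upd k phi x (s : 'Z_(m k)) : avg k phi (upd x s) = avg k phi x.
Proof. by rewrite /avg; congr (_ * _); apply: eq_bigr => t _; rewrite upd_upd. Qed.

Lemma avgC k l phi : avg k (avg l phi) = avg l (avg k phi).
Proof.
have [->//|kl] := eqVneq k l.
apply/funext => x; rewrite /avg -!mulr_sumr exchange_big /= mulrCA.
congr (_ * (_ * _)); apply: eq_bigr => s _; apply: eq_bigr => t _.
by rewrite updC.
Qed.

Lemma level_avg n k phi : level n phi -> level n (avg k phi).
Proof.
move=> h x y xy; congr (_ * _); apply: eq_bigr => s _; apply: h => j jn.
have [<-|kj] := eqVneq k j; first by rewrite !upd_in.
by rewrite !upd_out// xy.
Qed.

Lemma level_avg_last n phi : level n.+1 phi -> level n (avg n phi).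
Proof.
move=> h x y xy; congr (_ * _); apply: eq_bigr => s _; apply: h => j.
rewrite ltnS leq_eqVlt => /predU1P[->|jn]; first by rewrite !upd_in.
by rewrite !upd_out ?gtn_eqF// xy.
Qed.

(* Averages over the coordinates a, ..., a + d - 1; on functions of level a + d
   this is the conditional expectation given filtration a. *)
Fixpoint avgs (a d : nat) phi : X -> K :=
  if d is d'.+1 then avg a (avgs a.+1 d' phi) else phi.

Lemma avgs_cat a d e phi : avgs a (d + e) phi = avgs a d (avgs (a + d) e phi).
Proof. by elim: d a => [|d IH] a; rewrite ?addn0//= IH addSnnS. Qed.

Lemma avgs_last a d phi : avgs a d.+1 phi = avgs a d (avg (a + d) phi).
Proof. by rewrite -addn1 avgs_cat. Qed.

Lemma avgsD a d phi psi : avgs a d (fun x => phi x + psi x) = (fun x => avgs a d phi x + avgs a d psi x).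
Proof. by elim: d a => //= d IH a; rewrite IH avgD. Qed.

Lemma avgsM a d psi phi :
  (forall k, (a <= k < a + d)%N -> forall x (s : 'Z_(m k)), psi (upd x s) = psi x) ->
  avgs a d (fun x => psi x * phi x) = (fun x => psi x * avgs a d phi x).
Proof.
elim: d a => //= d IH a h; rewrite IH ?avgM//.
  by apply: h; rewrite leqnn addnS ltnS leq_addr.
by move=> k /andP[ak kd]; apply: h; rewrite (ltnW ak) addnS -addSn.
Qed.

Lemma avgsZ a d c phi : avgs a d (fun x => c * phi x) = (fun x => c * avgs a d phi x).
Proof. exact: (avgsM (psi := fun=> c)). Qed.

Lemma avgs_indep a d psi :
  (forall k, (a <= k < a + d)%N -> forall x (s : 'Z_(m k)), psi (upd x s) = psi x) ->
  avgs a d psi = psi.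
Proof.
elim: d a => //= d IH a h; rewrite IH ?avg_indep//.
  by apply: h; rewrite leqnn addnS ltnS leq_addr.
by move=> k /andP[ak kd]; apply: h; rewrite (ltnW ak) addnS -addSn.
Qed.

Lemma avgs_level_id n a d psi : (n <= a)%N -> level n psi -> avgs a d psi = psi.
Proof.
move=> na h; apply: avgs_indep => k /andP[ak _] x s.
by rewrite (level_upd _ _ h)// (leq_trans na).
Qed.

Lemma avgs0 a d : avgs a d (fun=> 0) = fun=> 0.
Proof. exact: avgs_indep. Qed.

Lemma avgs_sum a d (I : Type) (r : seq I) (P : pred I) (F : I -> X -> K) :
  avgs a d (fun x => \sum_(i <- r | P i) F i x) =
  (fun x => \sum_(i <- r | P i) avgs a d (F i) x).
Proof.
elim: r => [|i r IH].
  under eq_fun do rewrite big_nil; rewrite avgs0.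
  by apply/funext => x; rewrite big_nil.
under eq_fun do rewrite big_cons.
under [RHS]eq_fun do rewrite big_cons.
by case: (P i) => //; rewrite avgsD IH.
Qed.

Lemma avgs_ge0 a d phi : (forall x, 0 <= phi x) -> forall x, 0 <= avgs a d phi x.
Proof. by move=> h; elim: d a => //= d IH a; apply: avg_ge0. Qed.

Lemma avgs_le a d phi psi : (forall x, phi x <= psi x) ->
  forall x, avgs a d phi x <= avgs a d psi x.
Proof. by move=> h; elim: d a => //= d IH a; apply: avg_le. Qed.

Lemma avgs_avgC a d t phi : avgs a d (avg t phi) = avg t (avgs a d phi).
Proof. by elim: d a => //= d IH a; rewrite IH avgC. Qed.

(** Averages commute and are idempotent, so the extra one over coordinate t is absorbed. *)
Lemma avgs_avg a d t phi : (a <= t < a + d)%N -> avgs a d (avg t phi) = avgs a d phi.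
Proof.
elim: d a => [|d IH] a /=; first by rewrite addn0 ltnNge andbN.
move=> /andP[]; rewrite leq_eqVlt => /predU1P[<- _|at_ td].
  by rewrite avgs_avgC (avg_indep (psi := avg a _))// => x s; rewrite avg_upd.
by rewrite IH// at_ addSnnS.
Qed.

Lemma level_avgs n a d phi : level n phi -> level n (avgs a d phi).
Proof. by elim: d a => //= d IH a h; apply/level_avg/IH. Qed.

Lemma level_avgs_last a d phi : level (a + d) phi -> level a (avgs a d phi).
Proof.
elim: d a => [|d IH] a /=; first by rewrite addn0.
by rewrite -addSnnS => /IH /level_avg_last.
Qed.

(** The integral of a function of level L; once its L coordinates are averaged out, the base point
    no longer matters. *)
Definition mean (L : nat) phi : K := avgs 0 L phi point.

Lemma meanE L phi x : level L phi -> avgs 0 L phi x = mean L phi.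
Proof. by move=> h; apply: (level_avgs_last (a := 0) (d := L)). Qed.

Lemma mean_widen L L' phi : (L <= L')%N -> level L phi -> mean L' phi = mean L phi.
Proof. by move=> h l; rewrite /mean -(subnKC h) avgs_cat add0n (avgs_level_id _ (leqnn L) l). Qed.

Lemma mean_avg L t phi : (t < L)%N -> mean L (avg t phi) = mean L phi.
Proof. by move=> tL; rewrite /mean avgs_avg. Qed.

Lemma mean_avgs L a d phi : (a + d <= L)%N -> mean L (avgs a d phi) = mean L phi.
Proof.
elim: d a => //= d IH a; rewrite -addSnnS => h; rewrite mean_avg ?IH//.
by rewrite (leq_trans _ h)// leq_addr.
Qed.

Definition incyl (n : nat) (x : X) : X -> bool :=
  fun y => [forall k : 'I_n, coordinate y k == coordinate x k].

Lemma incylP n x y : reflect (forall k, (k < n)%N -> coordinate y k = coordinate x k) (incyl n x y).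
Proof.
apply: (iffP forallP) => [h k kn|h k]; last by rewrite h.
exact: (eqP (h (Ordinal kn))).
Qed.

Lemma incylS n x y : incyl n.+1 x y = incyl n x y && (coordinate y n == coordinate x n).
Proof.
apply/incylP/andP => [h|[/incylP h /eqP e] k].
  by split; [apply/incylP => k kn; apply: h; apply: ltnW|rewrite h].
by rewrite ltnS leq_eqVlt => /predU1P[->|/h].
Qed.

(** Averaging over the last coordinate keeps only the summand whose value is that of x, so each
    coordinate k contributes a factor 1/m_k. *)
Lemma avgs_cylinder_level n phi x y : level n phi ->
  avgs 0 n (fun y => (incyl n x y)%:R * phi y) y = (M n)%:R^-1 * phi x.
Proof.
elim: n phi => [|n IH] phi h.
  rewrite /= gen_power0 invr1 mul1r (_ : incyl 0 x y) ?mul1r; first exact: h.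
  exact/incylP.
rewrite avgs_last add0n.
have -> : avg n (fun y => (incyl n.+1 x y)%:R * phi y) =
    fun y => (m n)%:R^-1 * ((incyl n x y)%:R * phi (upd y (coordinate x n))).
  apply/funext => z; rewrite /avg; congr (_ * _).
  rewrite (bigD1 (coordinate x n))//= big1 ?addr0 => [|s sx].
    rewrite incylS upd_in eqxx andbT; congr ((nat_of_bool _)%:R * _).
    by apply/incylP/incylP => hh k kn; have := hh k kn; rewrite upd_out// gtn_eqF.
  by rewrite incylS upd_in (negPf sx) andbF mul0r.
rewrite avgsZ IH ?upd_id; last first.
  move=> u v uv; apply: h => k; rewrite ltnS leq_eqVlt => /predU1P[->|kn].
    by rewrite !upd_in.
  by rewrite !upd_out ?gtn_eqF// uv.
by rewrite gen_powerS natrM invfM mulrA [X in X * _]mulrC.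
Qed.

Lemma level_incyl n x : level n (incyl n x).
Proof.
move=> y z yz; apply/incylP/incylP => h k kn; first by rewrite -yz// h.
by rewrite yz// h.
Qed.

(** The indicator ignores the coordinates from n on, so these are averaged first; the remaining
    average picks out the cylinder, of measure 1/M_n. *)
Lemma mean_cylinder L n phi x : (n <= L)%N -> level L phi ->
  mean L (fun y => (incyl n x y)%:R * phi y) =
  (M n)%:R^-1 * avgs n (L - n) phi x.
Proof.
move=> nL h; rewrite /mean -{1}(subnKC nL) avgs_cat add0n avgsM.
  by rewrite avgs_cylinder_level//; apply: level_avgs_last; rewrite subnKC.
by move=> k /andP[nk _] y s; congr ((nat_of_bool _)%:R); apply: (level_upd _ _ (level_incyl _ )).
Qed.

End CoordinateAverages.

Lemma avgs_norm (K : numFieldType) a d (phi : X -> K) x :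
  `|avgs a d phi x| <= avgs a d (fun y => `|phi y|) x.
Proof.
elim: d a x => //= d IH a x; apply: (@le_trans _ _ (avg a (fun y => `|avgs a.+1 d phi y|) x)).
  by rewrite /avg normrM normfV normr_nat ler_wpM2l ?invr_ge0// ler_norm_sum.
exact: avg_le.
Qed.

End Averages.

(** * Measurability *)

Section Measure.
Context {m : nat -> nat}.
Local Notation X := (vilenkin m).

Lemma continuous_coordinate k :
  continuous ((fun x => x k) : vilenkin_space m -> discrete_topology 'Z_(m k)).
Proof. exact: (@proj_continuous nat (fun j => discrete_topology 'Z_(m j)) k). Qed.

Lemma measurable_coordinate k (s : 'Z_(m k)) :
  measurable [set x : X | coordinate x k = s].
Proof.
apply: sub_sigma_algebra.
have h := (continuousP _).1 (@continuous_coordinate k).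
exact: (h [set s] (discrete_open _)).
Qed.

(** Fixing the last coordinate cuts A into finitely many pieces, each a coordinate set intersected
    with a set of one level less. *)
Lemma measurable_level n (A : set X) : level n A -> measurable A.
Proof.
elim: n A => [|n IH] A hA.
  have [->|/set0P[x Ax]] := eqVneq A set0; first exact: measurable0.
  have -> : A = setT by apply/seteqP; split => // y _; rewrite (hA y x).
  exact: measurableT.
have -> : A = \bigcup_(s in [set: 'Z_(m n)])
    ([set x | coordinate x n = s] `&` [set x | A (upd x s)]).
  apply/seteqP; split => [x Ax|x [s _ [/= <-]]]; last by rewrite upd_id.
  by exists (coordinate x n) => //; split => //=; rewrite upd_id.
apply: fin_bigcup_measurable => [|s _]; first exact: finite_finset.
apply: measurableI; first exact: measurable_coordinate.
apply: IH => x y xy; apply: hA => j; rewrite ltnS leq_eqVlt => /predU1P[->|jn].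
  by rewrite !upd_in.
by rewrite !upd_out ?gtn_eqF// xy.
Qed.

Lemma level_cylinder n (x : X) : level n (cylinder n x).
Proof.
by move=> y z yz; apply/propeqP; split => h k kn; rewrite -h// yz.
Qed.

Lemma filtration_cylinder n (x : X) : filtration n (cylinder n x).
Proof. by apply: sub_sigma_algebra; exists x. Qed.

(** The sets of level n form a sigma-algebra that contains the generating cylinders. *)
Lemma filtration_level n (A : set X) : filtration n A -> level n A.
Proof.
apply: (@smallest_sub _ _ _ [set B | level n B]); last first.
  by move=> _ [x _ <-]; exact: level_cylinder.
split=> /=.
- by [].
- move=> B hB x y xy; rewrite setTD; apply/propeqP.
  by rewrite /setC /= (hB x y xy).
- move=> F hF x y xy; apply/propeqP; split => -[i _ Fi]; exists i => //.
    by rewrite -(hF i x y xy).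
  by rewrite (hF i x y xy).
Qed.

Lemma continuous_vilenkin_add (a : X) :
  continuous (vilenkin_add a : vilenkin_space m -> vilenkin_space m).
Proof.
move=> x; apply/cvg_sup; first by apply: fmap_filter; exact: (@nbhs_filter (vilenkin_space m)).
move=> i U [P [ [W oW <-] Px PU] ].
apply: (filterS PU).
  by apply: fmap_filter; exact: (@nbhs_filter (vilenkin_space m)).
apply: (@continuous_coordinate i x [set s | W (coordinate a i + s)]).
by apply: open_nbhs_nbhs; split; [exact: discrete_open|exact: Px].
Qed.

Lemma measurable_vilenkin_add (a : X) : measurable_fun setT (vilenkin_add a).
Proof.
apply: (@measurability _ _ X X setT (vilenkin_add a) (@open (vilenkin_space m))) => //.
move=> _ [A oA <-]; rewrite setTI; apply: sub_sigma_algebra.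
exact: ((continuousP _).1 (@continuous_vilenkin_add a)).
Qed.

End Measure.

(** * Integrals of functions of finitely many coordinates *)

Section Haar.
Context {R : realType} {m : nat -> nat}.
Hypothesis m_ge2 : forall k, (2 <= m k)%N.
Local Notation X := (vilenkin m).
Implicit Types phi : X -> R.

Lemma level_bounded n phi : level n phi -> exists C, forall x, `|phi x| <= C.
Proof.
elim: n phi => [|n IH] phi h.
  by exists `|phi point| => x; rewrite (h x point).
have H (s : 'Z_(m n)) : exists C, forall x, `|phi (upd x s)| <= C.
  apply: IH => x y xy; apply: h => j; rewrite ltnS leq_eqVlt => /predU1P[->|jn].
    by rewrite !upd_in.
  by rewrite !upd_out ?gtn_eqF// xy.
have [C hC] := choice H.
exists (\sum_s `|C s|) => x; rewrite -(upd_id x n).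
rewrite (le_trans (hC _ _))// (bigD1 (coordinate x n))//=.
by rewrite (le_trans (ler_norm _))// lerDl sumr_ge0.
Qed.

Lemma level_measurable d (T : measurableType d) n (phi : X -> T) :
  level n phi -> measurable_fun setT phi.
Proof.
move=> h _ B _; rewrite setTI; apply: (@measurable_level _ n) => x y xy.
by apply/propeqP; rewrite /= (h x y xy).
Qed.

Context (mu : probability X R).

Lemma level_integrable n phi : level n phi -> mu.-integrable setT (EFin \o phi).
Proof.
move=> h; apply: measurable_bounded_integrable => //.
- exact: fin_num_fun_lty.
- exact: level_measurable h.
have [C hC] := level_bounded h.
by exists C; split => [|M CM x _]; [exact: num_real|exact: le_trans (hC x) (ltW CM)].
Qed.

Hypothesis mu_haar : is_haar mu.

Lemma vilenkin_addK (a x : X) :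
  vilenkin_add (fun k => - coordinate a k) (vilenkin_add a x) = x.
Proof. by apply: vilenkin_ext => k; rewrite /coordinate /vilenkin_add /coordinate addKr. Qed.

Lemma integral_translate n phi (a : X) : level n phi ->
  (\int[mu]_x (phi (vilenkin_add a x))%:E = \int[mu]_x (phi x)%:E)%E.
Proof.
move=> h.
have ha : level n (fun x => phi (vilenkin_add a x)).
  by move=> x y xy; apply: h => k kn; rewrite /vilenkin_add /coordinate -/(coordinate x k) xy.
have mt := measurable_vilenkin_add a.
have mphi : measurable_fun [set: X] (EFin \o phi).
  by apply: (level_measurable (n := n)); exact: level_comp.
have := @integral_pushforward _ _ _ _ R _ mt mu setT _ mphi (level_integrable ha) measurableT.
rewrite preimage_setT => <-.
apply: eq_measure_integral => A mA _ /=.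
(* The preimage of [A] under translation by a is its image under translation by -a, to which
   invariance applies. *)
rewrite /pushforward -(mu_haar (fun k => - coordinate a k) mA).
congr (mu _); apply/seteqP; split => x /=.
  by exists (vilenkin_add a x) => //; rewrite vilenkin_addK.
move=> [y Ay <-]; suff -> : vilenkin_add a (vilenkin_add (fun k => - coordinate a k) y) = y by [].
by apply: vilenkin_ext => k; rewrite /coordinate /vilenkin_add /coordinate addrA addrN add0r.
Qed.

Definition unit_vec k (s : 'Z_(m k)) : X := upd (fun j => 0 : 'Z_(m j)) s.

(** Adding s to x_k instead of replacing x_k by s only permutes the summands. Averages thus become
    averages of translates, where Haar invariance can be used. *)
Lemma sum_upd_translate k phi x :
  \sum_(s : 'Z_(m k)) phi (upd x s) = \sum_(s : 'Z_(m k)) phi (vilenkin_add (unit_vec s) x).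
Proof.
rewrite (reindex_inj (addIr (coordinate x k))); apply: eq_bigr => s _; congr (phi _).
apply: vilenkin_ext => j; transitivity (coordinate (unit_vec s) j + coordinate x j) => //.
have [<-|kj] := eqVneq k j; first by rewrite /unit_vec !upd_in.
by rewrite /unit_vec !upd_out//; exact: esym (add0r _).
Qed.

Lemma integral_avg n k phi : level n phi ->
  (\int[mu]_x (avg k phi x)%:E = \int[mu]_x (phi x)%:E)%E.
Proof.
move=> h.
have ha (s : 'Z_(m k)) : level n (fun x => phi (vilenkin_add (unit_vec s) x)).
  by move=> x y xy; apply: h => j kn; rewrite /vilenkin_add /coordinate -/(coordinate x j) xy.
rewrite /avg; under eq_integral do rewrite sum_upd_translate EFinM.
rewrite integralZl//; last first.
  by apply: (@level_integrable n); apply: level_sum.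
under eq_integral do rewrite -sumEFin.
rewrite integral_sum//; last by move=> s; exact: level_integrable (ha s).
under eq_bigr do rewrite (integral_translate _ h).
have [r ->] : exists r, (\int[mu]_x (phi x)%:E)%E = r%:E.
  by exists (fine (\int[mu]_x (phi x)%:E)%E); rewrite fineK// integrable_fin_num// (level_integrable h).
rewrite sumEFin -EFinM sumr_const (card_coordinate m_ge2) -[X in (_ * X)%:E]mulr_natl.
by rewrite mulrA mulVf ?mul1r// modulus_neq0.
Qed.

(** Each coordinate average preserves the integral, and after all n of them the function is constant
    on a space of mass 1. *)
Lemma integral_mean n phi : level n phi ->
  (\int[mu]_x (phi x)%:E = (mean n phi)%:E)%E.
Proof.
move=> h.
have H a d : (\int[mu]_x (phi x)%:E = \int[mu]_x (avgs a d phi x)%:E)%E.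
  by elim: d a => //= d IH a; rewrite (@integral_avg n)//; exact: level_avgs.
rewrite (H 0%N n); under eq_integral do rewrite (meanE _ h).
rewrite integral_cst//; transitivity ((mean n phi)%:E * 1)%E; last by rewrite mule1.
by congr (_ * _)%E; exact: probability_setT.
Qed.

Lemma Rintegral_mean n phi : level n phi -> \int[mu]_x phi x = mean n phi.
Proof. by move=> h; rewrite /Rintegral (integral_mean h). Qed.

End Haar.

(** * Characters *)

Section Characters.
Local Open Scope complex_scope.
Context {R : realType}.

Definition cis (a : R) : R[i] := cos a +i* sin a.

Lemma cisD a b : cis (a + b) = cis a * cis b.
Proof. by apply/eqP; rewrite eq_complex /= cosD sinD eqxx /= addrC. Qed.

Lemma cisMn a n : cis (n%:R * a) = cis a ^+ n.
Proof.
elim: n => [|n IH]; first by rewrite mul0r /cis cos0 sin0.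
by rewrite -addn1 natrD mulrDl mul1r cisD IH exprD.
Qed.

Lemma mulcJ_cis a : cis a * conjc (cis a) = 1.
Proof.
apply/eqP; rewrite eq_complex /=; apply/andP; split; apply/eqP.
  by rewrite mulrN opprK -!expr2 cos2Dsin2.
by rewrite mulrN mulrC addNr.
Qed.

Lemma norm_cis a : `|cis a| = 1.
Proof. by rewrite normc_def /= cos2Dsin2 sqrtr1. Qed.

(** Half-angle formula: cos a = 1 - 2 sin^2(a/2), and sin(a/2) > 0 because 0 < a/2 < pi. *)
Lemma cis_neq1 a : 0 < a -> a < 2 * pi -> cis a != 1.
Proof.
move=> a0 a2; apply/negP => /eqP[ca _].
have e : a = (a / 2) *+ 2 by rewrite -mulr_natr divfK// pnatr_eq0.
have : 0 < sin (a / 2).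
  by apply: sin_gt0_pi; rewrite divr_gt0//= ltr_pdivrMr// mulrC.
move: ca; rewrite {1}e cos_mulr2n cos2sin2 => h /gt_eqF /eqP; apply.
by apply/eqP; rewrite -sqrf_eq0; apply/eqP; move: h; rewrite -mulr_natr => h; lra.
Qed.

Context {m : nat -> nat}.
Hypothesis m_ge2 : forall k, (2 <= m k)%N.
Local Notation X := (vilenkin m).
Local Notation M := (gen_power m).
Local Notation rad := (@rademacher R m).

Definition root1 k : R[i] := cis (2 * pi / (m k)%:R).

Lemma root1_expm k : root1 k ^+ m k = 1.
Proof.
have mk0 : (m k)%:R != 0 :> R by rewrite pnatr_eq0 -lt0n (leq_trans _ (m_ge2 k)).
rewrite -cisMn mulrC divfK// mulr_natl.
by rewrite /cis cos2pi sin2pi.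
Qed.

Lemma rademacherE k x : rad k x = root1 k ^+ (coordinate x k).
Proof. rewrite -cisMn /rademacher -/(cis _); congr cis. by rewrite mulrCA mulrA. Qed.

Lemma norm_rademacher k x : `|rad k x| = 1.
Proof. by rewrite rademacherE normrX norm_cis expr1n. Qed.

Definition vilenkin_sub (x y : X) : X := fun k => coordinate x k - coordinate y k.

(** [root1 k] is an m_k-th root of unity, so reducing the exponent modulo m_k changes nothing. *)
Lemma rademacher_sub k x y : rad k (vilenkin_sub x y) * rad k y = rad k x.
Proof.
have e : nat_of_ord (coordinate x k) =
    ((coordinate (vilenkin_sub x y) k + coordinate y k) %% m k)%N.
  rewrite -{1}(subrK (coordinate y k) (coordinate x k)) /=.
  by rewrite [X in (_ %% X)%N](Zp_cast (m_ge2 k)).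
by rewrite !rademacherE -exprD e expr_mod// root1_expm.
Qed.

Lemma rademacher_expm k x : rad k x ^+ m k = 1.
Proof. by rewrite rademacherE exprAC root1_expm expr1n. Qed.

(** The geometric sum times r - 1 is r^m - 1 = 0, and r = 1 only if the coordinate is 0. *)
Lemma sum_rademacher k x :
  \sum_(v < m k) rad k x ^+ v = ((m k) * (coordinate x k == 0))%:R.
Proof.
have [x0|x0] := eqVneq (coordinate x k) 0.
  under eq_bigr do rewrite rademacherE x0 expr0 expr1n.
  by rewrite sumr_const card_ord muln1.
rewrite muln0; apply/eqP.
have : (rad k x - 1) * \sum_(v < m k) rad k x ^+ v == 0.
  by rewrite -subrX1 rademacher_expm subrr.
rewrite mulf_eq0 subr_eq0 => /orP[|//]; rewrite rademacherE -cisMn => h.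
have xk0 : (0 < coordinate x k)%N by rewrite lt0n; apply: contra x0 => /eqP e; apply/eqP/val_inj.
have xkm : (coordinate x k < m k)%N by rewrite -[X in (_ < X)%N]Zp_cast.
have mk0 : 0 < (m k)%:R :> R by rewrite ltr0n (leq_trans _ (m_ge2 k)).
exfalso; move: h; apply/negP/cis_neq1.
  by rewrite mulr_gt0 ?ltr0n// divr_gt0// mulr_gt0 ?pi_gt0.
rewrite mulrCA gtr_pMr ?mulr_gt0 ?pi_gt0// ltr_pdivrMr// mul1r ltr_nat//.
Qed.

Lemma dvdn_gen_power j k : (j <= k)%N -> (M j %| M k)%N.
Proof.
elim: k => [|k IH]; first by rewrite leqn0 => /eqP ->.
rewrite leq_eqVlt => /predU1P[->//|]; rewrite ltnS => /IH h.
by rewrite gen_powerS dvdn_mulr.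
Qed.

Lemma digit_small n k : (n < M k)%N -> digit m n k = 0%N.
Proof. by move=> h; rewrite /digit divn_small// mod0n. Qed.

Lemma digit_block_top A u k : (k < M A)%N -> (u < m A)%N -> digit m (u * M A + k) A = u.
Proof.
by move=> kM um; rewrite /digit divnMDl ?gen_power_gt0// divn_small// addn0 modn_small.
Qed.

Lemma digit_block_low A u k j : (j < A)%N -> digit m (u * M A + k) j = digit m k j.
Proof.
move=> jA; rewrite /digit; have /dvdnP[c ->] := dvdn_gen_power jA.
rewrite gen_powerS [(M j * m j)%N]mulnC !mulnA divnMDl ?gen_power_gt0//.
by rewrite modnMDl.
Qed.

(** The digits of n from position N on vanish. As N may be smaller or larger than n, both products
    are compared with the one up to max(n, N). *)
Lemma psi_wide n N x : (n < M N)%N ->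
  psi R n x = \prod_(k < N) rad k x ^+ digit m n k.
Proof.
have H a b : (a <= b)%N -> (n < M a)%N ->
    \prod_(k < b) rad k x ^+ digit m n k = \prod_(k < a) rad k x ^+ digit m n k.
  move=> ab na; rewrite -(subnKC ab) big_split_ord /= [X in _ * X]big1 ?mulr1// => i _.
  by rewrite digit_small ?expr0// (leq_trans na)// leq_gen_power// leq_addr.
move=> nN; rewrite -(H N (maxn n N)) ?leq_maxr//.
by rewrite [RHS](H n) ?leq_maxl// ltn_gen_power.
Qed.

Lemma psi_block A u k x : (k < M A)%N -> (u < m A)%N ->
  psi R (u * M A + k) x = rad A x ^+ u * psi R k x.
Proof.
move=> kM um; rewrite (@psi_wide _ A.+1); last first.
  rewrite gen_powerS [X in (_ < X)%N]mulnC; apply: (@leq_trans (u.+1 * M A)).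
    by rewrite mulSn [X in (_ < X)%N]addnC ltn_add2l.
  by rewrite leq_mul2r um orbT.
rewrite big_ord_recr /= digit_block_top// mulrC (psi_wide _ kM).
by congr (_ * _); apply: eq_bigr => j _; rewrite digit_block_low.
Qed.

Lemma level_psi A k : (k < M A)%N -> level A (@psi R m k).
Proof.
move=> kM x y xy; rewrite !(psi_wide _ kM); apply: eq_bigr => j _.
by rewrite !rademacherE xy.
Qed.

(** The characters are multiplicative of modulus 1, so conjugation inverts them; this is what turns
    partial sums into convolutions. *)
Lemma psi_sub k x y : psi R k x * conjc (psi R k y) = psi R k (vilenkin_sub x y).
Proof.
have n1 : psi R k y * conjc (psi R k y) = 1.
  rewrite /psi rmorph_prod -big_split big1// => j _ /=.
  by rewrite rmorphXn -exprMn rademacherE -cisMn mulcJ_cis expr1n.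
have s : psi R k (vilenkin_sub x y) * psi R k y = psi R k x.
  by rewrite /psi -big_split; apply: eq_bigr => j _ /=; rewrite -exprMn rademacher_sub.
by rewrite -s -mulrA n1 mulr1.
Qed.

End Characters.

(** * Kernels *)

Section Kernels.
Local Open Scope complex_scope.
Context {R : realType} {m : nat -> nat} {b : nat}.
Hypothesis m_ge2 : forall k, (2 <= m k)%N.
Hypothesis m_le : forall k, (m k <= b)%N.
Local Notation X := (vilenkin m).
Local Notation M := (gen_power m).
Local Notation rad := (@rademacher R m).

Definition dirichlet n (x : X) : R[i] := \sum_(i < n) psi R i x.
(** The Fejer kernel without its factor 1/n; the index range matches S_0, ..., S_(n-1). *)
Definition fejer_sum n (x : X) : R[i] := \sum_(k < n) dirichlet k x.

Lemma dirichlet_block A u k x : (u < m A)%N -> (k <= M A)%N ->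
  dirichlet (u * M A + k) x = dirichlet (u * M A) x + rad A x ^+ u * dirichlet k x.
Proof.
move=> um kM; rewrite /dirichlet big_split_ord /=; congr (_ + _).
rewrite mulr_sumr; apply: eq_bigr => i _; rewrite psi_block//.
exact: leq_trans kM.
Qed.

Lemma dirichlet_mul A u x : (u <= m A)%N ->
  dirichlet (u * M A) x = (\sum_(w < u) rad A x ^+ w) * dirichlet (M A) x.
Proof.
elim: u => [|u IH] um; first by rewrite /dirichlet !big_ord0 mul0r.
by rewrite mulSnr dirichlet_block// IH ?(ltnW um)// big_ord_recr mulrDl.
Qed.

(* The first A coordinates vanish, except possibly the t-th one (no exception
   when t = A). *)
Definition near0 (A t : nat) (x : X) : bool :=
  [forall j : 'I_A, (j != t :> nat) ==> (coordinate x j == 0)].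

Lemma near0P A t x :
  reflect (forall j, (j < A)%N -> j != t -> coordinate x j = 0) (near0 A t x).
Proof.
apply: (iffP forallP) => [h j jA jt|h j].
  by have := h (Ordinal jA) => /= /implyP /(_ jt) /eqP.
by apply/implyP => jt; rewrite h.
Qed.

Lemma near0S A t x : (t < A)%N ->
  near0 A.+1 t x = (coordinate x A == 0) && near0 A t x.
Proof.
move=> tA; apply/near0P/andP => [h|[/eqP h0 /near0P h] j].
  split; first by rewrite h// gtn_eqF.
  by apply/near0P => j jA; apply: h; apply: ltnW.
by rewrite ltnS leq_eqVlt => /predU1P[->|jA] //; apply: h.
Qed.

Lemma near0_diag A x : near0 A.+1 A x = near0 A A x.
Proof.
apply/near0P/near0P => h j jA jt; apply: h => //; first exact: ltnW.
by move: jA; rewrite ltnS leq_eqVlt (negPf jt).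
Qed.

Lemma near0_diagS A x : near0 A.+1 A.+1 x = (coordinate x A == 0) && near0 A A x.
Proof.
apply/near0P/andP => [h|[/eqP h0 /near0P h] j].
  split; first by rewrite h// ltn_eqF.
  by apply/near0P => j jA _; apply: h; rewrite ?ltn_eqF// ltnW.
by rewrite ltnS leq_eqVlt => /predU1P[->|jA] // _; apply: h; rewrite // ltn_eqF.
Qed.

(** The classical value M_A on the cylinder of rank A at 0. Passing from A to A + 1 multiplies by
    the sum of the powers of r_A, which is m_A if z_A = 0 and 0 otherwise. *)
Lemma dirichlet_gen A x : dirichlet (M A) x = (M A * near0 A A x)%:R.
Proof.
elim: A => [|A IH].
  rewrite gen_power0 /dirichlet big_ord1 /psi big_ord0.
  by rewrite (_ : near0 0 0 x)//; apply/near0P.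
rewrite gen_powerS mulnC dirichlet_mul// IH sum_rademacher// -natrM; congr (_%:R).
by rewrite near0_diagS -mulnb; ring.
Qed.

Lemma fejer_sumD n n' x :
  fejer_sum (n + n') x = fejer_sum n x + \sum_(k < n') dirichlet (n + k) x.
Proof. by rewrite /fejer_sum big_split_ord. Qed.

Lemma fejer_block A u n x : (u < m A)%N -> (n <= M A)%N ->
  fejer_sum (u * M A + n) x =
  fejer_sum (u * M A) x + n%:R * dirichlet (u * M A) x + rad A x ^+ u * fejer_sum n x.
Proof.
move=> um nM; rewrite fejer_sumD -addrA; congr (_ + _).
under eq_bigr => k _ do rewrite dirichlet_block ?(leq_trans (ltnW (ltn_ord k)))//.
by rewrite big_split /= -mulr_sumr sumr_const card_ord mulr_natl.
Qed.

Lemma norm_dirichlet_mul A u x : (u <= m A)%N ->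
  `|dirichlet (u * M A) x| <= (b * (M A * near0 A A x))%:R.
Proof.
move=> um; rewrite dirichlet_mul// dirichlet_gen normrM normr_nat [leRHS]natrM.
rewrite ler_wpM2r// (le_trans (ler_norm_sum _ _ _))//.
under eq_bigr do rewrite normrX norm_rademacher expr1n.
by rewrite sumr_const card_ord ler_nat (leq_trans um).
Qed.

Definition kernel_bound A x := (\sum_(t < A.+1) M t * M A * near0 A t x)%N.

Lemma fejer_mul A u x : (u <= m A)%N -> fejer_sum (u * M A) x =
  \sum_(v < u) ((M A)%:R * dirichlet (v * M A) x) +
  (\sum_(v < u) rad A x ^+ v) * fejer_sum (M A) x.
Proof.
elim: u => [|u IH] um; first by rewrite /fejer_sum !big_ord0 mul0r addr0.
by rewrite mulSnr fejer_block// IH ?(ltnW um)// !big_ord_recr /=; ring.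
Qed.

(** One factor b bounds the Dirichlet kernels, the other the number u <= m_A of summands. *)
Lemma norm_fejer_mul_head A u x : (u <= m A)%N ->
  `|\sum_(v < u) ((M A)%:R * dirichlet (v * M A) x)| <=
  (b ^ 2 * (M A * M A * near0 A A x))%:R.
Proof.
move=> um; rewrite (le_trans (ler_norm_sum _ _ _))//.
apply: (@le_trans _ _ (\sum_(v < u) (M A * (b * (M A * near0 A A x)))%:R)).
  apply: ler_sum => v _; rewrite normrM normr_nat natrM ler_wpM2l//.
  by rewrite norm_dirichlet_mul// ltnW// (leq_trans (ltn_ord v)).
rewrite sumr_const card_ord -mulrnA ler_nat.
rewrite (_ : b ^ 2 * _ = M A * (b * (M A * near0 A A x)) * b)%N; last by ring.
by rewrite leq_mul2l (leq_trans um) ?orbT.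
Qed.

(* The sum of the powers r_A^v over v < m_A vanishes unless z_A = 0, so only
   points with at most one nonzero coordinate survive. *)
Lemma norm_fejer_gen A x : `|fejer_sum (M A) x| <=
  (b ^ 2 * \sum_(t < A) M t * M A * near0 A t x)%:R.
Proof.
elim: A => [|A IH].
  by rewrite gen_power0 /fejer_sum big_ord1 /dirichlet /= big_ord0 normr0.
rewrite {1}gen_powerS mulnC fejer_mul// (le_trans (ler_normD _ _))//.
rewrite sum_rademacher// normrM normr_nat.
apply: (le_trans (lerD (norm_fejer_mul_head _ (leqnn _)) (ler_wpM2l _ IH))) => //.
rewrite -natrM -natrD ler_nat big_ord_recr /= mulnDr addnC leq_add//; last first.
  by rewrite near0_diag leq_mul2l leq_mul2r leq_mul2l leq_gen_power// !orbT.
rewrite mulnCA leq_mul2l; apply/orP; right; rewrite big_distrr /=; apply: leq_sum => t _.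
by rewrite near0S// -mulnb gen_powerS; apply: eq_leq; ring.
Qed.

(** Induction on L, removing the leading digit u of the index: the remainder falls under the
    induction hypothesis and all other terms are bounded by [kernel_bound L]. *)
Lemma norm_fejer L n x : (n <= M L)%N ->
  `|fejer_sum n x| <= (2 * b ^ 3 * \sum_(A < L) kernel_bound A x)%:R.
Proof.
have b2 : (2 <= b)%N := leq_trans (m_ge2 0) (m_le 0).
elim: L n => [|L IH] n.
  rewrite gen_power0; case: n => [|[|//]] _; rewrite /fejer_sum.
    by rewrite !big_ord0 normr0.
  by rewrite big_ord1 /dirichlet /= !big_ord0 normr0.
case: n => [_|n]; first by rewrite /fejer_sum big_ord0 normr0.
rewrite gen_powerS => nM.
(* Dividing n rather than n + 1 keeps the remainder in 1, ..., M_L and u < m_L even when n + 1 =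
   M_(L+1). *)
have ->: n.+1 = (n %/ M L * M L + (n %% M L).+1)%N by rewrite addnS -divn_eq.
set u := (n %/ M L)%N; set n' := (n %% M L).+1.
have um : (u < m L)%N by rewrite /u ltn_divLR ?gen_power_gt0// mulnC.
have nn : (n' <= M L)%N by rewrite /n' ltn_mod gen_power_gt0.
rewrite fejer_block// fejer_mul ?(ltnW um)//.
rewrite big_ord_recr /= mulnDr natrD (le_trans (ler_normD _ _))// addrC.
rewrite lerD//; first by rewrite normrM normrX norm_rademacher expr1n mul1r IH.
rewrite (le_trans (ler_normD _ _))//.
apply: (le_trans (lerD (ler_normD _ _) (lexx _))).
have h1 := norm_fejer_mul_head x (ltnW um).
have h2 : `|(\sum_(v < u) rad L x ^+ v) * fejer_sum (M L) x| <=
    (b * (b ^ 2 * \sum_(t < L) M t * M L * near0 L t x))%:R.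
  rewrite normrM natrM ler_pM ?norm_fejer_gen// (le_trans (ler_norm_sum _ _ _))//.
  under eq_bigr do rewrite normrX norm_rademacher expr1n.
  by rewrite sumr_const card_ord ler_nat (leq_trans (ltnW um)).
have h3 : `|n'%:R * dirichlet (u * M L) x| <= (M L * (b * (M L * near0 L L x)))%:R.
  by rewrite normrM normr_nat natrM ler_pM ?ler_nat// norm_dirichlet_mul// ltnW.
apply: (le_trans (lerD (lerD h1 h2) h3)); rewrite -!natrD ler_nat.
rewrite /kernel_bound big_ord_recr /=.
set S := (\sum_(t < L) _)%N; set D := near0 L L x : nat; set P := M L.
(* The summands t < L receive b^3 from [h2]; the summand t = L receives b^2 from [h1] and b from
   [h3]. *)
have b3 : (b ^ 2 + b <= 2 * b ^ 3)%N by nia.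
have := leq_mul b3 (leqnn (P * P * D)).
nia.
Qed.

End Kernels.

(** * Partial sums of a martingale *)

Section Martingales.
Local Open Scope complex_scope.
Context {R : realType} {m : nat -> nat} {b : nat}.
Hypothesis m_ge2 : forall k, (2 <= m k)%N.
Hypothesis m_le : forall k, (m k <= b)%N.
Local Notation X := (vilenkin m).
Local Notation M := (gen_power m).
Context (mu : probability X R).
Hypothesis mu_haar : is_haar mu.
Local Notation Re := (@complex.Re R).
Local Notation Im := (@complex.Im R).
Local Notation normc := Normc.normc.

Lemma natV_real n : n%:R^-1 = (n%:R^-1)%:C :> R[i].
Proof. by rewrite fmorphV rmorph_nat. Qed.

(** [h] is only additive and compatible with division by naturals, so that real part, imaginary part
    and the real embedding are all covered. *)
Lemma avgs_morph (K K' : numFieldType) (h : K -> K') a d (phi : X -> K) :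
  h 0 = 0 -> {morph h : x y / x + y} ->
  (forall n z, h (n%:R^-1 * z) = n%:R^-1 * h z) ->
  (fun x => h (avgs a d phi x)) = avgs a d (fun x => h (phi x)).
Proof.
move=> h0 hD hZ; elim: d a => //= d IH a; rewrite -IH; apply/funext => x.
by rewrite /avg hZ (big_morph h hD h0).
Qed.

Lemma Re_avgs a d (phi : X -> R[i]) x : Re (avgs a d phi x) = avgs a d (fun y => Re (phi y)) x.
Proof.
rewrite -(@avgs_morph _ _ Re)// => [ [? ?] [? ?] //|n [u v]].
by rewrite natV_real /= mul0r subr0.
Qed.

Lemma Im_avgs a d (phi : X -> R[i]) x : Im (avgs a d phi x) = avgs a d (fun y => Im (phi y)) x.
Proof.
rewrite -(@avgs_morph _ _ Im)// => [ [? ?] [? ?] //|n [u v]].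
by rewrite natV_real /= mul0r addr0.
Qed.

Lemma real_complex_avgs a d (phi : X -> R) x :
  (avgs a d phi x)%:C = avgs a d (fun y => (phi y)%:C) x.
Proof.
rewrite -(@avgs_morph _ _ (@real_complex R))//; first exact: rmorphD.
by move=> n z; rewrite rmorphM /= -natV_real.
Qed.

Lemma cintegral_mean n (g : X -> R[i]) : level n g -> cintegral mu setT g = mean n g.
Proof.
move=> h; rewrite /cintegral !(Rintegral_mean m_ge2 mu_haar (n := n)); try exact: level_comp.
by apply/eqP; rewrite eq_complex /= /mean Re_avgs Im_avgs !eqxx.
Qed.

Lemma Rintegral_cylinder n N (phi : X -> R) x : (n <= N)%N -> level N phi ->
  \int[mu]_(y in cylinder n x) phi y = (M n)%:R^-1 * avgs n (N - n) phi x.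
Proof.
move=> nN h; rewrite -(mean_cylinder _ _ h)// Rintegral_mkcond.
rewrite -(Rintegral_mean m_ge2 mu_haar); last first.
  move=> y z yz; rewrite (h y z yz); congr ((nat_of_bool _)%:R * _).
  by apply: level_incyl => k kn; rewrite yz// (leq_trans kn).
congr (Rintegral _ _ _); apply/funext => y; rewrite /patch.
case: ifPn; rewrite ?inE ?notin_setE => hy.
  by rewrite (_ : incyl n x y) ?mul1r//; apply/incylP.
by rewrite (_ : incyl n x y = false) ?mul0r//; apply/incylP.
Qed.

Section OneMartingale.
Context (f : nat -> X -> R[i]).
Hypothesis mf : martingale mu f.

(** Adaptedness puts the preimages of points under the real and imaginary parts into [filtration n],
    whose members have level n. *)
Lemma martingale_level n : level n (f n).
Proof.
move=> x y xy; have [ad _ _] := mf n; apply/eqP; rewrite eq_complex.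
have [/filtration_level hr _] := ad [set Re (f n x)] (measurable_set1 _).
have [_ /filtration_level hi] := ad [set Im (f n x)] (measurable_set1 _).
have := hr x y xy; have := hi x y xy; rewrite /preimage /= => hi' hr'.
have <- : Re (f n y) = Re (f n x) by rewrite -hr'.
have <- : Im (f n y) = Im (f n x) by rewrite -hi'.
by rewrite !eqxx.
Qed.

(** The martingale identity is tested on the cylinder of rank n around x, over which the integral is
    1/M_n times the average at x. *)
Lemma martingale_avg n : avg n (f n.+1) = f n.
Proof.
apply/funext => x; have [_ _ /(_ _ (@filtration_cylinder m n x))] := mf n.
have l1 : level n.+1 (f n.+1) by exact: martingale_level.
have l0 : level n (f n) by exact: martingale_level.
rewrite /cintegral !(Rintegral_cylinder (n := n) (N := n.+1)) //;
  try exact: level_comp; try by apply: (level_widen (leqnSn n)); exact: level_comp.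
have M0 : (M n)%:R^-1 != 0 :> R by rewrite invr_eq0 pnatr_eq0 -lt0n gen_power_gt0.
rewrite subSnn => -[/(mulfI M0) hr /(mulfI M0) hi].
have -> : f n x = avg n (f n) x.
  by rewrite (avg_indep m_ge2)// => y s; apply: level_upd l0 (leqnn _).
apply/eqP; rewrite eq_complex -[avg n _]/(avgs n 1 _) -[avg n (f n)]/(avgs n 1 _).
by rewrite !Re_avgs !Im_avgs /= hr hi !eqxx.
Qed.

Lemma martingale_mean n d (psi : X -> R[i]) : level n psi ->
  mean (n + d) (fun y => f (n + d) y * psi y) = mean n (fun y => f n y * psi y).
Proof.
move=> h; elim: d => [|d IH]; first by rewrite addn0.
rewrite -IH addnS /mean avgs_last add0n; congr (avgs _ _ _ _).
under eq_fun do rewrite mulrC.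
rewrite (avgM (psi := psi)); last by move=> x s; apply: level_upd h (leq_addr _ _).
by rewrite martingale_avg; apply/funext => x; rewrite mulrC.
Qed.

Lemma level_fourier_integrand L i : (i < M L)%N ->
  level L (fun y => f L y * conjc (psi R i y)).
Proof.
move=> iL; apply: (level_comp2 (fun u v => u * conjc v)); first exact: martingale_level.
exact: level_psi.
Qed.

(** The sequence under the limit is constant from L on, since psi_i has level L and later martingale
    steps average out. *)
Lemma fourier_coefE L i : (i < M L)%N ->
  fourier_coef mu f i = mean L (fun y => f L y * conjc (psi R i y)).
Proof.
move=> iL; rewrite /fourier_coef; apply: (@norm_lim_near_cst R[i] (R[i])^o); exists L => // N /= LN.
rewrite -(subnKC LN) (cintegral_mean (n := L + (N - L))); last first.
  apply: level_fourier_integrand; apply: leq_trans iL _.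
  by rewrite leq_gen_power// leq_addr.
by rewrite martingale_mean//; apply: (level_comp (fun z => conjc z)); exact: level_psi.
Qed.

(** All indices stay below M_L, so [f L] determines every coefficient, and [psi_sub] collects the
    characters into a convolution kernel. *)
Lemma sum_partial_sumE L n x : (n <= M L)%N ->
  \sum_(k < n) partial_sum mu k f x =
  mean L (fun y => f L y * fejer_sum n (vilenkin_sub x y)).
Proof.
move=> nL; rewrite /mean.
under [in RHS]eq_fun do rewrite /fejer_sum mulr_sumr.
rewrite avgs_sum //=; apply: eq_bigr => k _.
under [in RHS]eq_fun do rewrite /dirichlet mulr_sumr.
rewrite avgs_sum //= /partial_sum; apply: eq_bigr => i _.
rewrite (fourier_coefE (L := L)); last first.
  by rewrite (leq_trans _ nL)// (ltn_trans (ltn_ord i)).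
rewrite mulrC /mean -[LHS](congr1 (@^~ point) (avgsZ _ _ _ _)); congr (avgs _ _ _ _).
by apply/funext => y; rewrite -psi_sub// mulrCA.
Qed.

(** The term (A, t) majorizes the convolution of g with M_t M_A 1{[near0 A t]}: M_A cancels the
    measure of a cylinder, and s runs over the values of the exceptional coordinate. *)
Definition kernel_op L (g : X -> R) x : R :=
  \sum_(A < L) \sum_(t < A.+1) (M t)%:R * \sum_(s : 'Z_(m t)) avgs A (L - A) g (upd x s).

(** If x - y vanishes on the first A coordinates except at t, then y lies in the cylinder of x with
    coordinate t replaced by y_t. *)
Lemma near0_le A t (x y : X) :
  (near0 A t (vilenkin_sub x y) <= \sum_(s : 'Z_(m t)) incyl A (upd x s) y)%N.
Proof.
case: near0P => // h; rewrite (bigD1 (coordinate y t))//=.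
rewrite (_ : incyl _ _ _ = true) ?leq_addr//; apply/incylP => k kA.
have [->|kt] := eqVneq t k; first by rewrite upd_in.
rewrite upd_out//; have := h k kA; rewrite eq_sym => /(_ kt) /eqP.
by rewrite subr_eq0 => /eqP ->.
Qed.

Lemma mean_kernel_bound L g x : level L g -> (forall y, 0 <= g y) ->
  mean L (fun y => g y * (\sum_(A < L) kernel_bound A (vilenkin_sub x y))%:R)
  <= kernel_op L g x.
Proof.
move=> hg g0.
pose h y : R := \sum_(A < L) \sum_(t < A.+1) (M t * M A)%:R *
   \sum_(s : 'Z_(m t)) (incyl A (upd x s) y)%:R * g y.
apply: (@le_trans _ _ (mean L h)).
  apply: avgs_le => y; rewrite /h natr_sum mulr_sumr; apply: ler_sum => A _.
  rewrite /kernel_bound natr_sum mulr_sumr; apply: ler_sum => t _.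
  rewrite natrM mulrCA ler_wpM2l// -mulr_suml mulrC ler_wpM2r//.
  by rewrite -natr_sum ler_nat near0_le.
rewrite /mean /h avgs_sum //= /kernel_op; apply: ler_sum => A _.
rewrite avgs_sum //=; apply: ler_sum => t _.
rewrite avgsZ avgs_sum //= natrM -mulrA ler_wpM2l// mulr_sumr.
apply: ler_sum => s _; rewrite -[X in _ * X]/(mean L _) mean_cylinder//; last exact: ltnW.
by rewrite mulrA divff ?mul1r// pnatr_eq0 -lt0n gen_power_gt0.
Qed.

Lemma normc_sum_partial_sum L n g x : (n <= M L)%N -> level L g ->
  (forall y, normc (f L y) <= g y) ->
  normc (\sum_(k < n) partial_sum mu k f x) <= (2 * b ^ 3)%:R * kernel_op L g x.
Proof.
move=> nL hg fg; have g0 y : 0 <= g y.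
  by apply: le_trans (fg y); rewrite -ler0c; exact: (normr_ge0 (f L y)).
rewrite (sum_partial_sumE _ nL) -lecR.
have -> z : (normc z)%:C = `|z| by [].
apply: le_trans (avgs_norm _ _ _ _) _.
apply: (@le_trans _ _ (mean L (fun y => ((2 * b ^ 3)%:R * (g y *
   (\sum_(A < L) kernel_bound A (vilenkin_sub x y))%:R))%:C))).
  apply: avgs_le => y; rewrite normrM mulrCA -natrM rmorphM /= rmorph_nat.
  apply: ler_pM => //; first by rewrite lecR.
  exact: norm_fejer.
rewrite /mean -real_complex_avgs lecR avgsZ ler_wpM2l//.
exact: mean_kernel_bound.
Qed.

End OneMartingale.

End Martingales.

(** * Quasi-norm estimates *)

Section QuasiNorm.
Context {R : realType} {m : nat -> nat}.
Hypothesis m_ge2 : forall k, (2 <= m k)%N.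
Local Notation X := (vilenkin m).
Local Notation M := (gen_power m).
Context (p : R).
Hypotheses (p_gt0 : 0 < p) (p_le1 : p <= 1).
Implicit Types u v w : X -> R.

Let p_neq0 : p != 0. Proof. by rewrite gt_eqF. Qed.

Lemma gen_powerR_gt0 k : 0 < (M k)%:R :> R.
Proof. by rewrite ltr0n gen_power_gt0. Qed.

Lemma avg_minkowski a u v x : (forall y, 0 <= u y) -> (forall y, 0 <= v y) ->
  avg a (fun y => (u y + v y) `^ p^-1) x `^ p <=
  avg a (fun y => u y `^ p^-1) x `^ p + avg a (fun y => v y `^ p^-1) x `^ p.
Proof.
move=> u0 v0; rewrite /avg.
have S0 w : 0 <= \sum_(s : 'Z_(m a)) w (upd x s) `^ p^-1.
  by rewrite sumr_ge0// => s _; rewrite powR_ge0.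
rewrite (powRM _ _ (S0 u)) ?invr_ge0// (powRM _ _ (S0 v)) ?invr_ge0//.
rewrite (powRM _ _ (S0 (fun y => u y + v y))) ?invr_ge0// -mulrDr.
by rewrite ler_wpM2l ?powR_ge0// minkowski_sum.
Qed.

Lemma avgs_powR_ge0 a d u x : 0 <= avgs a d (fun y => u y `^ p^-1) x.
Proof. by apply: avgs_ge0 => y; rewrite powR_ge0. Qed.

(** Iterated norms: the inner average is the (1/p)-th power of its norm [N w], so induction bounds
    the inner norm of u + v by [N u + N v] and the one-coordinate inequality applies to these. *)
Lemma avgs_minkowski a d u v x : (forall y, 0 <= u y) -> (forall y, 0 <= v y) ->
  avgs a d (fun y => (u y + v y) `^ p^-1) x `^ p <=
  avgs a d (fun y => u y `^ p^-1) x `^ p + avgs a d (fun y => v y `^ p^-1) x `^ p.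
Proof.
move=> u0 v0; elim: d a x => [|d IH] a x /=; first by rewrite !powRVK// addr_ge0.
pose N w y := avgs a.+1 d (fun z => w z `^ p^-1) y `^ p.
have E w : avgs a.+1 d (fun z => w z `^ p^-1) = fun y => N w y `^ p^-1.
  by apply/funext => y; rewrite /N powRKV// avgs_powR_ge0.
rewrite (E u) (E v) (le_trans _ (avg_minkowski _ _ _ _))// => [|y|y]; try exact: powR_ge0.
apply: ler_powR_base; first exact: ltW.
  by apply: avg_ge0 => y; rewrite avgs_powR_ge0.
apply: avg_le => y; rewrite -(powRKV p_neq0 (avgs_powR_ge0 a.+1 d (fun z => u z + v z) y)).
by apply: ler_powR_base (IH _ _); rewrite ?invr_ge0 ?powR_ge0// ltW.
Qed.

Lemma avgs_minkowski_sum a d n (v : nat -> X -> R) x : (forall j y, 0 <= v j y) ->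
  avgs a d (fun y => (\sum_(j < n) v j y) `^ p^-1) x `^ p <=
  \sum_(j < n) avgs a d (fun y => v j y `^ p^-1) x `^ p.
Proof.
move=> v0; elim: n => [|n IH].
  under eq_fun do rewrite big_ord0 powR0 ?invr_eq0//.
  by rewrite avgs0// big_ord0 powR0.
under eq_fun do rewrite big_ord_recr /=.
rewrite big_ord_recr /= (le_trans (avgs_minkowski _ _ _ _ _))//; last by rewrite lerD2r.
by move=> y; rewrite sumr_ge0.
Qed.

(** Jensen's inequality goes the other way for p <= 1; subadditivity of t^p is used instead, at the
    price of m_a^(1 - p). *)
Lemma avg_powR_le a w x : (forall y, 0 <= w y) ->
  avg a w x `^ p <= (m a)%:R `^ (1 - p) * avg a (fun y => w y `^ p) x.
Proof.
move=> w0; have ma0 : 0 < (m a)%:R :> R by rewrite ltr0n (leq_trans _ (m_ge2 a)).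
rewrite /avg powRM ?invr_ge0 ?sumr_ge0// mulrA.
have -> : (m a)%:R `^ (1 - p) * (m a)%:R^-1 = (m a)%:R^-1 `^ p :> R.
  rewrite -(powR_inv1 (ltW ma0)) -powRrM mulN1r -powRD; last by rewrite (gt_eqF ma0) implybT.
  by congr (_ `^ _); ring.
by rewrite ler_wpM2l ?powR_ge0// powR_le_sum.
Qed.

Lemma avgs_powR_le a d w x : (forall y, 0 <= w y) ->
  avgs a d w x `^ p <=
  ((M (a + d))%:R / (M a)%:R) `^ (1 - p) * avgs a d (fun y => w y `^ p) x.
Proof.
move=> w0; elim: d a x => [|d IH] a x /=.
  by rewrite addn0 divff ?powR1 ?mul1r// gt_eqF ?gen_powerR_gt0.
rewrite (le_trans (avg_powR_le _ _ _))//; first exact: avgs_ge0.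
rewrite -addSnnS; set q := (M (a.+1 + d))%:R.
have -> : q / (M a)%:R = (m a)%:R * (q / (M a.+1)%:R) :> R.
  have ma0 := modulus_neq0 m_ge2 (K := R) a.
  by rewrite gen_powerS natrM; field; rewrite ma0 gt_eqF ?gen_powerR_gt0.
rewrite powRM ?divr_ge0// -mulrA ler_wpM2l ?powR_ge0//.
rewrite -[leRHS](congr1 (@^~ x) (@avgM _ _ _ (fun=> _) _ _)) //.
exact: avg_le.
Qed.

(** Averages from coordinate j on act trivially on v, so only A, ..., j - 1 cost anything; for j <=
    A the ratio is 1. *)
Lemma avgs_powR_level_le A L j v x : (A <= L)%N -> (j <= L)%N -> level j v ->
  (forall y, 0 <= v y) ->
  avgs A (L - A) (fun y => v y `^ p^-1) x `^ p <=
  ((M (maxn A j))%:R / (M A)%:R) `^ (1 - p) * avgs A (L - A) v x.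
Proof.
move=> AL jL hv v0; have hv' : level j (fun y => v y `^ p^-1) by apply: (level_comp (fun z => z `^ p^-1)).
have [jA|/ltnW Aj] := leqP j A.
  rewrite !(avgs_level_id m_ge2 _ jA)// powRVK// divff ?powR1 ?mul1r//.
  by rewrite gt_eqF ?gen_powerR_gt0.
have -> : (L - A = (j - A) + (L - j))%N by lia.
rewrite !avgs_cat subnKC// !(avgs_level_id m_ge2 _ (leqnn j))//.
rewrite (le_trans (avgs_powR_le _ _ _ _))// => [y|]; first exact: powR_ge0.
by rewrite subnKC//; under eq_fun do rewrite powRVK//.
Qed.

(** * Running maxima, their increments, and the kernel operator *)

Context (F : nat -> X -> R).
Hypotheses (F_level : forall n, level n (F n)) (F_ge0 : forall n x, 0 <= F n x).

(** The p-th powers are maximized, so that the means of the increments telescope to the mean of the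
    p-th power of the running maximum. *)
Fixpoint max_power (n : nat) (x : X) : R :=
  if n is n'.+1 then Num.max (max_power n' x) (F n x `^ p) else F 0 x `^ p.

Definition max_power_incr (n : nat) (x : X) : R :=
  if n is n'.+1 then max_power n x - max_power n' x else max_power 0 x.

(* The maximum of F 0 x, ..., F n x. *)
Definition running_max n x := max_power n x `^ p^-1.

Lemma max_power_ge0 n x : 0 <= max_power n x.
Proof. by case: n => [|n] /=; rewrite ?le_max ?powR_ge0 ?orbT. Qed.

Lemma max_power_incr_ge0 n x : 0 <= max_power_incr n x.
Proof. by case: n => [|n] /=; rewrite ?powR_ge0// subr_ge0 le_max lexx. Qed.

Lemma sum_max_power_incr n x : \sum_(j < n.+1) max_power_incr j x = max_power n x.
Proof.
elim: n => [|n IH]; first by rewrite big_ord1.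
by rewrite big_ord_recr IH /= addrC subrK.
Qed.

Lemma level_max_power n : level n (max_power n).
Proof.
elim: n => [|n IH] x y xy /=; first by rewrite (F_level xy).
rewrite (F_level xy) (IH x y)// => k kn; apply: xy; exact: ltnW.
Qed.

Lemma level_max_power_incr n : level n (max_power_incr n).
Proof.
case: n => [|n] x y xy; rewrite /max_power_incr; first exact: level_max_power.
by rewrite (level_max_power xy) (@level_max_power n x y)// => k kn; apply: xy; exact: ltnW.
Qed.

Lemma level_running_max n : level n (running_max n).
Proof. by apply: (level_comp (fun z => z `^ p^-1)); exact: level_max_power. Qed.

Lemma running_max_ge n x : F n x <= running_max n x.
Proof.
rewrite -{1}(powRKV p_neq0 (F_ge0 n x)); apply: ler_powR_base.
- by rewrite invr_ge0 ltW.
- exact: powR_ge0.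
- by case: n => [|n] /=; rewrite ?le_max ?lexx ?orbT.
Qed.

Lemma running_max_ge0 n x : 0 <= running_max n x. Proof. exact: powR_ge0. Qed.

Definition incr_mean j : R := mean j (max_power_incr j).

Lemma incr_mean_ge0 j : 0 <= incr_mean j.
Proof. by apply: avgs_ge0 => x; exact: max_power_incr_ge0. Qed.

Lemma sum_incr_mean n : \sum_(j < n.+1) incr_mean j = mean n (max_power n).
Proof.
have -> : max_power n = fun y => \sum_(j < n.+1) max_power_incr j y.
  by apply/funext => y; rewrite sum_max_power_incr.
rewrite /mean avgs_sum//=; apply: eq_bigr => j _.
rewrite -[RHS]/(mean n _) (mean_widen m_ge2 (L := j))//; last exact: level_max_power_incr.
by rewrite -ltnS.
Qed.

(** Minkowski splits the running maximum into increments; the j-th has level j, so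
    [avgs_powR_level_le] applies, and the mean absorbs the remaining averages. *)
Lemma mean_avgs_running_max A L : (A <= L)%N ->
  mean L (fun x => avgs A (L - A) (running_max L) x `^ p) <=
  \sum_(j < L.+1) ((M (maxn A j))%:R / (M A)%:R) `^ (1 - p) * incr_mean j.
Proof.
move=> AL.
pose h x := \sum_(j < L.+1) ((M (maxn A j))%:R / (M A)%:R) `^ (1 - p) * avgs A (L - A) (max_power_incr j) x.
apply: (@le_trans _ _ (mean L h)).
  apply: avgs_le => x.
  have -> : running_max L = fun y => (\sum_(j < L.+1) max_power_incr j y) `^ p^-1.
    by apply/funext => y; rewrite sum_max_power_incr.
  rewrite (le_trans (avgs_minkowski_sum _ _ _ _ _))//; first exact: max_power_incr_ge0.
  apply: ler_sum => j _; apply: avgs_powR_level_le => //; last exact: max_power_incr_ge0.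
    by rewrite -ltnS.
  exact: level_max_power_incr.
rewrite /h /mean avgs_sum//=; apply: ler_sum => j _; rewrite avgsZ.
rewrite ler_wpM2l ?powR_ge0// -[leLHS]/(mean L _) mean_avgs ?subnKC// le_eqVlt.
by rewrite (mean_widen m_ge2 (L := j)) ?eqxx -1?ltnS//; exact: level_max_power_incr.
Qed.

Lemma level_kernel_op L (g : X -> R) : level L g -> level L (kernel_op L g).
Proof.
move=> hg x y xy; apply: eq_bigr => A _; apply: eq_bigr => t _; congr (_ * _).
apply: eq_bigr => s _; apply: (level_avgs A (L - A) hg) => k kL.
have [<-|tk] := eqVneq (t : nat) k; first by rewrite !upd_in.
by rewrite !upd_out// xy.
Qed.

Lemma kernel_op_ge0 L (g : X -> R) x : (forall y, 0 <= g y) -> 0 <= kernel_op L g x.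
Proof.
move=> g0; apply: sumr_ge0 => A _; apply: sumr_ge0 => t _.
by rewrite mulr_ge0// sumr_ge0// => s _; apply: avgs_ge0.
Qed.

(** Subadditivity of t^p moves the power inside all three sums. The sum over s is then m_t <= b
    times an average, which the mean absorbs. *)
Lemma mean_kernel_op (b : nat) L (g : X -> R) : (forall k, (m k <= b)%N) ->
  (forall y, 0 <= g y) ->
  mean L (fun x => kernel_op L g x `^ p) <=
  b%:R * \sum_(A < L) (\sum_(t < A.+1) (M t)%:R `^ p) *
     mean L (fun x => avgs A (L - A) g x `^ p).
Proof.
move=> m_le g0.
pose h x := \sum_(A < L) \sum_(t < A.+1) (M t)%:R `^ p *
  \sum_(s : 'Z_(m t)) avgs A (L - A) g (upd x s) `^ p.
have E0 A d x : 0 <= avgs A d g x by apply: avgs_ge0.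
have s0 A d t x : 0 <= \sum_(s : 'Z_(m t)) avgs A d g (upd x s) by rewrite sumr_ge0.
have t0 (A : 'I_L) (t : 'I_A.+1) x :
  0 <= (M t)%:R * \sum_(s : 'Z_(m t)) avgs A (L - A) g (upd x s) by rewrite mulr_ge0.
apply: (@le_trans _ _ (mean L h)).
  apply: avgs_le => x; rewrite (le_trans (powR_le_sum _ _ _ _ _))//.
    by move=> A; rewrite sumr_ge0.
  apply: ler_sum => A _; rewrite (le_trans (powR_le_sum _ _ _ _ _))//.
  apply: ler_sum => t _; rewrite powRM//.
  by rewrite ler_wpM2l ?powR_ge0// powR_le_sum.
rewrite /h /mean avgs_sum//= mulr_sumr; apply: ler_sum => A _.
rewrite avgs_sum//= mulrA [b%:R * _]mulrC -mulrA mulr_suml; apply: ler_sum => t _.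
rewrite avgsZ ler_wpM2l ?powR_ge0//.
pose k y := avgs A (L - A) g y `^ p.
under eq_fun => x do rewrite -/(k _) (sum_upd m_ge2 _ k).
rewrite avgsZ -[X in _ * X <= _]/(mean L _) mean_avg//; last first.
  by rewrite (leq_ltn_trans _ (ltn_ord A))// -ltnS.
rewrite ler_wpM2r ?ler_nat//.
by apply: avgs_ge0 => x; exact: powR_ge0.
Qed.

End QuasiNorm.

(** * Summation over levels *)

(** The offset [d] is 1 when increments up to level B + 1 occur at level B, and 0 for plain
    triangles; truncated subtraction lets j = 0 start at B = 0. *)
Lemma exchange_big_triangle (V : nmodType) (d K : nat) (G : nat -> nat -> V) :
  \sum_(B < K) \sum_(j < B.+1 + d) G B j =
  \sum_(j < K + d) \sum_(j - d <= B < K) G B j.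
Proof.
elim: K => [|K IH]; first by rewrite big_ord0 big1// => j _; rewrite big_geq.
rewrite big_ord_recr /= IH.
transitivity (\sum_(j < K.+1 + d) (\sum_(j - d <= B < K) G B j + G K j)).
  rewrite big_split /=; congr (_ + _).
  rewrite [RHS]big_ord_recr /= [X in _ = _ + X]big_geq ?addr0//.
  by rewrite addnK.
apply: eq_bigr => j _; rewrite big_nat_recr//=.
by have := ltn_ord j; lia.
Qed.

Section LevelSums.
Context {R : realType} {m : nat -> nat} {b : nat}.
Hypothesis m_ge2 : forall k, (2 <= m k)%N.
Hypothesis m_le : forall k, (m k <= b)%N.
Local Notation X := (vilenkin m).
Local Notation M := (gen_power m).
Local Notation Mr k := ((gen_power m k)%:R : R).

Let Mr_gt0 k : 0 < Mr k. Proof. exact: gen_powerR_gt0. Qed.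
Let b_ge1 : 1 <= b%:R :> R.
Proof. by rewrite ler1n (leq_trans _ (m_le 0))// (leq_trans _ (m_ge2 0)). Qed.

(** The sum of the geometric series of ratio 2^(-r), which governs sums of M_k^r and M_k^(-r)
    because M_k at least doubles at each step. *)
Definition geo_const (r : R) : R := (1 - 2 `^ (- r))^-1.

Let two_lt1 (r : R) : 0 < r -> 2 `^ (- r) < 1 :> R.
Proof.
move=> r0; rewrite powRN invf_lt1 ?powR_gt0//.
by have := @gt0_ltr_powR R r r0 1 2; rewrite !nnegrE powR1 ltr1n => ->.
Qed.

Lemma geo_const_ge0 r : 0 < r -> 0 <= geo_const r.
Proof. by move=> r0; rewrite invr_ge0 subr_ge0 ltW// two_lt1. Qed.

Lemma gen_power_step r k : 0 < r -> Mr k `^ r <= 2 `^ (- r) * Mr k.+1 `^ r.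
Proof.
move=> r0; rewrite powRN ler_pdivlMl ?powR_gt0// -powRM//.
by apply: ler_powR_base; rewrite ?(ltW r0)// -natrM ler_nat gen_power_double.
Qed.

Lemma sum_gen_power_last r n : 0 < r ->
  \sum_(k < n.+1) Mr k `^ r <= geo_const r * Mr n `^ r.
Proof.
move=> r0; apply: (geometric_sum_last (a := fun k => Mr k `^ r)).
- exact: powR_ge0.
- exact: two_lt1.
- by move=> k; exact: powR_ge0.
- by move=> k; exact: gen_power_step.
Qed.

Lemma sum_gen_power_first r i n : 0 < r ->
  \sum_(i <= k < n) Mr k `^ (- r) <= geo_const r * Mr i `^ (- r).
Proof.
move=> r0; apply: (geometric_sum_first (a := fun k => Mr k `^ (- r))).
- exact: powR_ge0.
- exact: two_lt1.
- by move=> k; exact: powR_ge0.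
- move=> k; rewrite (powRN (Mr k)) ler_pdivlMr ?powR_gt0//.
  by rewrite (powRN (Mr k.+1)) mulrC ler_pdivrMr ?powR_gt0// gen_power_step.
Qed.

Lemma gen_powerS_le k : Mr k.+1 <= b%:R * Mr k.
Proof. by rewrite gen_powerS mulnC natrM ler_wpM2r// ler_nat. Qed.

Lemma powR_base_le (r : R) : 0 <= r -> r <= 1 -> b%:R `^ r <= b%:R :> R.
Proof. by move=> r0 r1; rewrite ler1_powR. Qed.

Context (p : R).
Hypotheses (p_gt0 : 0 < p) (p_half : p <= 2^-1).

Let p_le1 : p <= 1. Proof. by move: p_half => h; lra. Qed.
Let p'_gt0 : 0 < 1 - p. Proof. by move: p_half => h; lra. Qed.

Context (F : nat -> X -> R).
Hypothesis F_level : forall n, level n (F n).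

Local Notation e := (incr_mean p F).

Definition kernel_op_mean L : R := mean L (fun x => kernel_op L (running_max p F L) x `^ p).

(* Bounded in n for p < 1/2, and equal to n + 1 for p = 1/2. *)
Definition critical_sum n : R := \sum_(A < n.+1) Mr A `^ (2 * p - 1).

Lemma critical_sum_ge0 n : 0 <= critical_sum n.
Proof. by rewrite sumr_ge0// => A _; rewrite powR_ge0. Qed.

Lemma le_critical_sum i j : (i <= j)%N -> critical_sum i <= critical_sum j.
Proof.
move=> ij; rewrite /critical_sum -!(big_mkord xpredT (fun A => Mr A `^ (2 * p - 1))).
by rewrite (@big_cat_nat _ _ _ i.+1 0 j.+1)//= lerDl sumr_ge0// => A _; rewrite powR_ge0.
Qed.

Lemma sum_gen_power_le_critical i j k : (k <= j.+1)%N ->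
  \sum_(i <= A < k) Mr A `^ (2 * p - 1) <= critical_sum j.
Proof.
move=> kj; rewrite /critical_sum -(big_mkord xpredT (fun A => Mr A `^ (2 * p - 1))).
have [ki|ik] := leqP k i.
  by rewrite [leLHS]big_geq// sumr_ge0// => A _; rewrite powR_ge0.
rewrite (@big_cat_nat _ _ _ i 0 j.+1)//=; last by rewrite (leq_trans (ltnW ik)).
rewrite (@big_cat_nat _ _ _ k i j.+1)//=; last exact: ltnW.
rewrite addrCA lerDl addr_ge0// sumr_ge0// => A _; exact: powR_ge0.
Qed.

(** For j <= A the left side is the first summand, for A <= j the second. The critical exponent 2p -
    1 arises as p - (1 - p). *)
Lemma gen_power_maxn_le A j :
  Mr A `^ p * (Mr (maxn A j) / Mr A) `^ (1 - p) <=
  Mr A `^ p + Mr A `^ (2 * p - 1) * Mr j `^ (1 - p).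
Proof.
have [jA|/ltnW Aj] := leqP j A.
  by rewrite divff ?gt_eqF// powR1 mulr1 lerDl mulr_ge0 ?powR_ge0.
rewrite powRM ?invr_ge0// -(powR_inv1 (ltW (Mr_gt0 A))) -powRrM.
rewrite [Mr j `^ _ * _]mulrC mulrA -powRD; last by rewrite (gt_eqF (Mr_gt0 A)) implybT.
rewrite (_ : p + -1 * (1 - p) = 2 * p - 1); last by ring.
by rewrite lerDr powR_ge0.
Qed.

(** The sum over t is geometric, of order M_A^p. After exchanging A and j, [gen_power_maxn_le]
    separates a geometric sum over A from the critical one. *)
Lemma kernel_op_mean_le L : kernel_op_mean L <=
  b%:R * geo_const p * \sum_(j < L.+1) (geo_const p * Mr L `^ p + critical_sum L * Mr j `^ (1 - p)) * e j.
Proof.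
have e0 j : 0 <= e j by exact: incr_mean_ge0.
rewrite (le_trans (mean_kernel_op m_ge2 p_gt0 p_le1 L m_le (running_max_ge0 p F L)))//.
rewrite -mulrA ler_wpM2l//.
apply: (@le_trans _ _ (geo_const p * \sum_(A < L) Mr A `^ p *
    \sum_(j < L.+1) (Mr (maxn A j) / Mr A) `^ (1 - p) * e j)).
  rewrite mulr_sumr; apply: ler_sum => A _; rewrite mulrA ler_pM//.
  - by rewrite sumr_ge0// => t _; rewrite powR_ge0.
  - by apply: avgs_ge0 => x; exact: powR_ge0.
  - exact: sum_gen_power_last.
  - by apply: mean_avgs_running_max => //; exact: ltnW.
rewrite ler_wpM2l ?geo_const_ge0//.
under eq_bigr do rewrite mulr_sumr.
rewrite exchange_big /=; apply: ler_sum => j _.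
under eq_bigr do rewrite mulrA.
rewrite -mulr_suml ler_wpM2r//.
apply: (@le_trans _ _ (\sum_(A < L) (Mr A `^ p + Mr A `^ (2 * p - 1) * Mr j `^ (1 - p)))).
  by apply: ler_sum => A _; exact: gen_power_maxn_le.
rewrite big_split /= -mulr_suml lerD//.
  rewrite (le_trans _ (sum_gen_power_last L p_gt0))// big_ord_recr /= lerDl.
  exact: powR_ge0.
rewrite ler_wpM2r ?powR_ge0//.
by rewrite /critical_sum big_ord_recr /= lerDl powR_ge0.
Qed.

(** The first summand accounts for M_(B+1)^p <= b M_B^p, the second for the geometric tail of M_B^(p
    - 1) over B >= j - 1. *)
Definition level_const : R := b%:R * geo_const p * (geo_const p * b%:R + geo_const (1 - p) * b%:R).

Lemma sum_kernel_op_mean_le K :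
  \sum_(B < K) Mr B `^ (p - 1) * kernel_op_mean B.+1 <= level_const * critical_sum K * mean K (max_power p F K).
Proof.
have e0 j : 0 <= e j by exact: incr_mean_ge0.
have g0 : 0 <= geo_const p by apply: geo_const_ge0.
have g1 : 0 <= geo_const (1 - p) by apply: geo_const_ge0.
have MM B r s : Mr B `^ r * Mr B `^ s = Mr B `^ (r + s).
  by rewrite -powRD// (gt_eqF (Mr_gt0 B)) implybT.
(* The bound of [kernel_op_mean_le] at level B + 1 times M_B^(p - 1), with the critical sum enlarged
   to level K. *)
pose G B j := (geo_const p * b%:R * Mr B `^ (2 * p - 1) +
   critical_sum K * Mr j `^ (1 - p) * Mr B `^ (p - 1)) * e j.
apply: (@le_trans _ _ (b%:R * geo_const p * \sum_(B < K) \sum_(j < B.+1 + 1) G B j)).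
  rewrite mulr_sumr; apply: ler_sum => B _.
  rewrite (le_trans (ler_wpM2l (powR_ge0 _ _) (kernel_op_mean_le _)))// mulrCA.
  rewrite ler_wpM2l ?mulr_ge0// addn1 mulr_sumr; apply: ler_sum => j _.
  rewrite /G mulrA ler_wpM2r// mulrDr lerD//.
    rewrite mulrCA -mulrA ler_wpM2l//.
    rewrite (_ : 2 * p - 1 = (p - 1) + p); last by ring.
    rewrite -(MM B (p - 1) p) mulrCA ler_wpM2l ?powR_ge0//.
    apply: (@le_trans _ _ ((b%:R * Mr B) `^ p)).
      by apply: ler_powR_base; rewrite ?gen_powerS_le// ltW.
    by rewrite powRM// ler_wpM2r ?powR_ge0// powR_base_le// ltW.
  rewrite mulrC ler_wpM2r ?powR_ge0// ler_wpM2r ?powR_ge0//.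
  exact: le_critical_sum.
rewrite exchange_big_triangle addn1 -sum_incr_mean// /level_const -!mulrA.
rewrite !ler_wpM2l// mulr_sumr mulr_sumr; apply: ler_sum => j _.
rewrite /G -mulr_suml [leRHS]mulrA ler_wpM2r// big_split /= -!mulr_sumr [leRHS]mulrDl lerD//.
  rewrite ler_wpM2l ?mulr_ge0//; exact: sum_gen_power_le_critical.
rewrite [leRHS]mulrC -mulrA ler_wpM2l ?critical_sum_ge0//.
rewrite -(opprB 1 p) (le_trans (ler_wpM2l (powR_ge0 _ _) (sum_gen_power_first _ _ p'_gt0)))//.
rewrite mulrCA ler_wpM2l// powRN ler_pdivrMr ?powR_gt0//.
(* The tail starts at j - 1, and M_j <= b M_(j-1) compensates; for j = 0 this reads M_0 <= b M_0. *)
apply: (@le_trans _ _ ((b%:R * Mr (j - 1)) `^ (1 - p))).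
  apply: ler_powR_base => //; first exact: ltW.
  case: (j : nat) => [|k]; last by rewrite subn1 gen_powerS_le.
  by rewrite sub0n ler_peMl.
rewrite powRM// ler_wpM2r ?powR_ge0// powR_base_le//; first exact: ltW.
by rewrite gerBl ltW.
Qed.

End LevelSums.

(** * T means *)

Section Means.
Local Open Scope complex_scope.
Context {R : realType} {m : nat -> nat}.
Local Notation X := (vilenkin m).
Local Notation normc := Normc.normc.
Context (mu : probability X R).

Lemma normc_ge0 (z : R[i]) : 0 <= normc z.
Proof. by rewrite -ler0c; exact: (normr_ge0 z). Qed.

Lemma normc_real (a : R) : normc a%:C = `|a|.
Proof. by rewrite /= expr0n addr0 sqrtr_sqr. Qed.

Lemma normc_sum_le n (d : nat -> R) (w : nat -> R[i]) : (forall k, 0 <= d k) ->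
  normc (\sum_(k < n) (d k)%:C * w k) <= \sum_(k < n) d k * normc (w k).
Proof.
move=> d0; elim: n => [|n IH]; first by rewrite !big_ord0 Normc.normc0.
rewrite !big_ord_recr /= (le_trans (le_normcD _ _))// lerD//.
by rewrite Normc.normcM normc_real ger0_norm.
Qed.

Section Weights.
Context (q : nat -> R).
Hypotheses (q_noninc : nonincreasing_seq q) (q_ge0 : forall k, 0 <= q k) (q0_gt0 : 0 < q 0%N).

Lemma weight_sum_gt0 n : 0 < weight_sum q n.+1.
Proof.
by rewrite /weight_sum big_ord_recl ltr_wpDr// sumr_ge0.
Qed.

Lemma q_diff_ge0 k : 0 <= q k - q k.+1.
Proof. by rewrite subr_ge0; apply: q_noninc. Qed.

(** Abel summation: the differences of [q] are nonnegative, so the bounds [w] can be inserted term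
    by term. *)
Lemma T_mean_le f n x (w : nat -> R) :
  (forall l, (l <= n.+1)%N -> normc (\sum_(k < l) partial_sum mu k f x) <= w l) ->
  normc (T_mean mu q n.+1 f x) <= (weight_sum q n.+1)^-1 *
    (\sum_(k < n) (q k - q k.+1) * w k.+1 + q n * w n.+1).
Proof.
move=> hw; rewrite /T_mean Normc.normcM normc_real ger0_norm; last first.
  by rewrite invr_ge0 ltW// weight_sum_gt0.
rewrite ler_wpM2l//; first by rewrite invr_ge0 ltW// weight_sum_gt0.
rewrite (sum_abel (fun k => (q k)%:C) (fun k => partial_sum mu k f x)).
rewrite (le_trans (le_normcD _ _))// lerD//; last first.
  by rewrite Normc.normcM normc_real ger0_norm// ler_wpM2l// hw.
under eq_bigr do rewrite -rmorphB.
rewrite (le_trans (@normc_sum_le n (fun k => q k - q k.+1)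
  (fun k => \sum_(j < k.+1) partial_sum mu j f x) q_diff_ge0))//.
apply: ler_sum => k _; rewrite ler_wpM2l ?q_diff_ge0// hw//.
by rewrite ltnS ltnW.
Qed.

(** For a bound linear in l, Abel summation read backwards reassembles the weights into Q_(n+1) Y,
    which cancels the normalization whatever the size of the weights. *)
Lemma T_mean_le_linear f n x (Y : R) :
  (forall l, (l <= n.+1)%N -> normc (\sum_(k < l) partial_sum mu k f x) <= l%:R * Y) ->
  normc (T_mean mu q n.+1 f x) <= Y.
Proof.
move=> /T_mean_le/le_trans; apply.
have <- : \sum_(k < n.+1) q k * Y =
    \sum_(k < n) (q k - q k.+1) * (k.+1%:R * Y) + q n * (n.+1%:R * Y).
  rewrite (sum_abel q (fun=> Y)); congr (_ + _); last by rewrite sumr_const card_ord mulr_natl.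
  by apply: eq_bigr => k _; rewrite sumr_const card_ord mulr_natl.
by rewrite -mulr_suml mulrA mulVf ?mul1r// gt_eqF// weight_sum_gt0.
Qed.

(** For a constant bound the differences of [q] telescope to q_0. *)
Lemma T_mean_le_const f n x (Z : R) :
  (forall l, (l <= n.+1)%N -> normc (\sum_(k < l) partial_sum mu k f x) <= Z) ->
  normc (T_mean mu q n.+1 f x) <= (weight_sum q n.+1)^-1 * q 0%N * Z.
Proof.
move=> hw; have := @T_mean_le f n x (fun=> Z) hw; rewrite -mulr_suml -mulrDl mulrA.
suff -> : \sum_(k < n) (q k - q k.+1) + q n = q 0%N by [].
elim: n {hw} => [|n IH]; first by rewrite big_ord0 add0r.
by rewrite big_ord_recr /= -IH; ring.
Qed.

(** Comparing all weights with q_n gives n q_n <= Q_n and Q_N <= Q_n + (N - n) q_n. *)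
Lemma weight_sum_avg n N : (n <= N)%N -> n%:R * weight_sum q N <= N%:R * weight_sum q n.
Proof.
move=> nN; rewrite -(subnKC nN); set d := (N - n)%N.
have h1 : n%:R * q n <= weight_sum q n.
  rewrite mulr_natl -[n in _ *+ n]card_ord -sumr_const; apply: ler_sum => k _.
  by apply: q_noninc; apply: ltnW; exact: ltn_ord.
have h2 : weight_sum q (n + d) <= weight_sum q n + d%:R * q n.
  rewrite /weight_sum big_split_ord /= lerD2l mulr_natl -[X in _ *+ X]card_ord -sumr_const.
  by apply: ler_sum => k _; apply: q_noninc; exact: leq_addr.
have := ler_wpM2l (ler0n R n) h2; rewrite natrD; have := ler_wpM2l (ler0n R d) h1.
by rewrite mulrDr mulrDl => h3 h4; rewrite (le_trans h4)// lerD2l mulrCA.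
Qed.

(* Q_n / n is nonincreasing, so the asymptotic condition already holds, with the
   same constant, at every n >= 1. *)
Lemma weight_sumV_le (C : R) n :
  (\forall n \near \oo, `|(weight_sum q n)^-1| <= C * `|n%:R^-1|) ->
  (weight_sum q n.+1)^-1 <= C * n.+1%:R^-1.
Proof.
move=> [N _ hN]; pose K := maxn N n.+1.
have /= := hN K (leq_maxl _ _).
have K0 : (0 < K)%N by rewrite (leq_trans _ (leq_maxr _ _)).
have QK : 0 < weight_sum q K by rewrite -(prednK K0) weight_sum_gt0.
have Qn := weight_sum_gt0 n.
rewrite !ger0_norm ?invr_ge0// ?(ltW QK)// => h.
have := weight_sum_avg (leq_maxr N n.+1); rewrite -/K => hav.
have K0' : 0 < K%:R :> R by rewrite ltr0n.
have n0' : 0 < n.+1%:R :> R by rewrite ltr0n.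
have h' : K%:R <= C * weight_sum q K.
  by rewrite -ler_pdivrMr// mulrC -ler_pdivlMr.
rewrite ler_pdivlMr// mulrC ler_pdivrMr//.
rewrite -(ler_pM2r K0') (le_trans (ler_wpM2l (ltW n0') h'))//.
have C0 : 0 <= C.
  by rewrite -(pmulr_lge0 _ QK) (le_trans _ h')// ltW.
by rewrite mulrCA [leRHS]mulrAC -mulrA ler_wpM2l// [leRHS]mulrC.
Qed.

End Weights.

End Means.

(** * Norms of the T means on blocks of indices between consecutive M_A *)

Section Final.
Local Open Scope complex_scope.
Context {R : realType} {m : nat -> nat} {b : nat}.
Hypothesis m_ge2 : forall k, (2 <= m k)%N.
Hypothesis m_le : forall k, (m k <= b)%N.
Local Notation X := (vilenkin m).
Local Notation M := (gen_power m).
Local Notation Mr k := ((gen_power m k)%:R : R).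
Local Notation normc := Normc.normc.
Context (mu : probability X R).
Hypothesis mu_haar : is_haar mu.
Context (p : R).
Hypothesis p_gt0 : 0 < p.

Let Mr_gt0 k : 0 < Mr k. Proof. exact: gen_powerR_gt0. Qed.
Let p_neq0 : p != 0. Proof. by rewrite gt_eqF. Qed.

Lemma level_exists l : (0 < l)%N -> exists B, (M B <= l < M B.+1)%N.
Proof.
move=> l0; suff H K : (l < M K)%N -> exists B, (M B <= l < M B.+1)%N.
  by apply: (H l); exact: ltn_gen_power.
elim: K => [|K IH]; first by rewrite gen_power0 ltnNge l0.
have [lK _|Kl h] := ltnP l (M K); first exact: IH.
by exists K; rewrite Kl.
Qed.

Lemma gen_power_ltn_inv A B : (M A < M B)%N -> (A < B)%N.
Proof. by rewrite !ltnNge; apply: contra => /(leq_gen_power m_ge2). Qed.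

Lemma sum_level_blocks (a : nat -> \bar R) K :
  (\sum_(1 <= k < M K) a k = \sum_(A < K) \sum_(M A <= k < M A.+1) a k)%E.
Proof.
elim: K => [|K IH]; first by rewrite gen_power0 big_geq// big_ord0.
rewrite big_ord_recr /= -IH (@big_cat_nat _ _ _ (M K))//= ?gen_power_gt0//.
by rewrite leq_gen_power.
Qed.

(** The block M_A <= k < M_(A+1) contains at most b M_A indices. *)
Lemma sum_level_blocks_le (a : nat -> \bar R) (r : nat -> R) K :
  (forall A, 0 <= r A) ->
  (forall A k, (A < K)%N -> (M A <= k < M A.+1)%N -> (a k <= (r A)%:E)%E) ->
  (\sum_(1 <= k < M K) a k <= (b%:R * \sum_(A < K) Mr A * r A)%:E)%E.
Proof.
move=> r0 ar; rewrite sum_level_blocks mulr_sumr -sumEFin; apply: lee_sum => A _.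
apply: (@le_trans _ _ (\sum_(M A <= k < M A.+1) (r A)%:E)%E).
  by rewrite big_nat [leRHS]big_nat; apply: lee_sum => k kA; apply: ar.
rewrite sumEFin lee_fin sumr_const_nat -[leLHS]mulr_natl mulrA ler_wpM2r//.
rewrite -natrM ler_nat (leq_trans (leq_subr _ _))// gen_powerS mulnC.
by rewrite leq_mul2r m_le orbT.
Qed.

Context (f : nat -> X -> R[i]).
Hypothesis mf : martingale mu f.

Definition absf n x : R := normc (f n x).

Lemma absf_level n : level n (absf n).
Proof. by move=> x y xy; rewrite /absf (martingale_level mf xy). Qed.

Lemma absf_ge0 n x : 0 <= absf n x. Proof. exact: normc_ge0. Qed.

Local Notation H := (hardy_norm mu p f `^ p)%E.
Local Notation kop L := (kernel_op L (running_max p absf L)).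
Local Notation C0 := ((2 * b ^ 3)%:R : R).
Local Notation W l x := (\sum_(k < l) partial_sum mu k f x).

Lemma maximal_ge0 x : (0 <= maximal f x)%E.
Proof.
apply: (@le_trans _ _ (normc (f 0%N x))%:E); first by rewrite lee_fin normc_ge0.
by apply: ereal_sup_ubound; exists 0%N.
Qed.

Lemma max_power_le_maximal K x : ((max_power p absf K x)%:E <= maximal f x `^ p)%E.
Proof.
have h n : ((absf n x `^ p)%:E <= maximal f x `^ p)%E.
  rewrite -poweR_EFin; apply: gt0_ler_poweR; first exact: ltW.
  - by rewrite in_itv /= leey lee_fin absf_ge0.
  - by rewrite in_itv /= leey maximal_ge0.
  - by apply: ereal_sup_ubound; exists n.
by elim: K => [|K IH] //=; rewrite EFin_max ge_max IH h.
Qed.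

Lemma measurable_maximal : measurable_fun [set: X] (maximal f).
Proof.
have -> : maximal f = fun x => esups (fun n => (normc (f n x))%:E) 0%N.
  apply/funext => x; rewrite /maximal /esups /sdrop /=; congr ereal_sup.
  by apply/seteqP; split => [_ [n _ <-]|_ [n _ <-]]; exists n.
apply: (measurable_fun_esups (f := fun n x => (normc (f n x))%:E)) => n.
apply: (level_measurable (n := n)); apply: (level_comp (fun z => (normc z)%:E)).
exact: (martingale_level mf).
Qed.

Lemma mean_max_power_le K : ((mean K (max_power p absf K))%:E <= H)%E.
Proof.
have lu := level_max_power p absf_level (n := K).
rewrite /hardy_norm poweR_Lnorm// -(integral_mean m_ge2 mu_haar lu).
apply: ge0_le_integral => //.
- by move=> x _; rewrite lee_fin max_power_ge0.
- by apply: (level_measurable (n := K)); apply: (level_comp EFin).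
- apply: (measurableT_comp (measurable_poweR _)).
  by apply: measurableT_comp => //; exact: measurable_maximal.
- by move=> x _; rewrite gee0_abs ?maximal_ge0// max_power_le_maximal.
Qed.

Lemma norm_W_le L l x : (l <= M L)%N -> normc (W l x) <= C0 * kop L x.
Proof.
move=> lL; apply: (normc_sum_partial_sum m_ge2 m_le mu_haar mf x lL).
  exact/level_running_max/absf_level.
by move=> y; apply: running_max_ge => //; exact: absf_ge0.
Qed.

Lemma kop_ge0 L x : 0 <= kop L x.
Proof. by apply: kernel_op_ge0 => y; exact: running_max_ge0. Qed.

Lemma level_kop L : level L (kop L).
Proof. exact/level_kernel_op/level_running_max/absf_level. Qed.

Section Weights.
Context (q : nat -> R).
Hypotheses (q_noninc : nonincreasing_seq q) (q_ge0 : forall k, 0 <= q k) (q0_gt0 : 0 < q 0%N).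
Local Notation T := (T_mean mu q).

Lemma cLnorm_T_mean L n : (n <= M L)%N ->
  (cLnorm mu p (T n f) `^ p = (mean L (fun x => (normc (T n f x)) `^ p))%:E)%E.
Proof.
move=> nL; have lT : level L (T n f).
  move=> x y xy; congr (_ * _); apply: eq_bigr => k _; congr (_ * _).
  apply: eq_bigr => i _; congr (_ * _); apply: (@level_psi R m m_ge2 L i _ x y xy).
  by rewrite (leq_trans _ nL)// (ltn_trans (ltn_ord i)).
rewrite /cLnorm poweR_Lnorm// -(integral_mean m_ge2 mu_haar); last first.
  exact: (level_comp (fun z => normc z `^ p)).
apply: eq_integral => x _.
by rewrite gee0_abs ?lee_fin ?normc_ge0// poweR_EFin.
Qed.

(** For l in block B, the operator of level B + 1 is at most l times its quotient by M_B, and that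
    quotient is at most S^(1/p). This is a linear bound, as [T_mean_le_linear] requires. *)
Lemma normc_T_mean_powR A n x : (M A <= n.+1 < M A.+1)%N ->
  normc (T n.+1 f x) `^ p <=
  C0 `^ p * \sum_(B < A.+1) Mr B `^ (- p) * kop B.+1 x `^ p.
Proof.
move=> /andP[_ nA]; set S := \sum_(B < _) _.
have t0 B : 0 <= Mr B `^ (- p) * kop B.+1 x `^ p by rewrite mulr_ge0 ?powR_ge0.
have S0 : 0 <= S by rewrite sumr_ge0.
rewrite -(powRVK p_neq0 S0) -powRM ?powR_ge0//.
apply: ler_powR_base; [exact: ltW|exact: normc_ge0|].
apply: T_mean_le_linear => // l ln.
have [->|l0] := posnP l; first by rewrite big_ord0 Normc.normc0 mul0r.
have [B /andP[Bl lB]] := level_exists l0.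
rewrite (le_trans (norm_W_le x (ltnW lB)))// mulrCA ler_wpM2l//.
have BA : (B < A.+1)%N.
  by apply: gen_power_ltn_inv; rewrite (leq_ltn_trans Bl)// (leq_ltn_trans ln).
apply: (@le_trans _ _ (Mr B * (Mr B `^ (- p) * kop B.+1 x `^ p) `^ p^-1)).
  rewrite powRM ?powR_ge0// powRKV ?kop_ge0// -powRrM mulNr divff//.
  by rewrite powR_inv1// mulrA divff ?mul1r// gt_eqF.
apply: ler_pM => //; rewrite ?powR_ge0 ?ler_nat//.
apply: ler_powR_base; rewrite ?invr_ge0 ?(ltW p_gt0)//.
by rewrite /S (bigD1 (Ordinal BA))//= lerDl sumr_ge0.
Qed.

Lemma cLnorm_T_mean_le A n : (M A <= n < M A.+1)%N ->
  (cLnorm mu p (T n f) `^ p <=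
   (C0 `^ p * \sum_(B < A.+1) Mr B `^ (- p) * kernel_op_mean p absf B.+1)%:E)%E.
Proof.
case: n => [|n] hn; first by move: hn; rewrite leqNgt gen_power_gt0.
rewrite (@cLnorm_T_mean A.+1) ?lee_fin; last by case/andP: hn => _ /ltnW.
apply: (le_trans (avgs_le _ _ (fun x => normc_T_mean_powR x hn) _)).
rewrite avgsZ; cbv beta; rewrite ler_wpM2l ?powR_ge0// avgs_sum//; apply: ler_sum => B _.
rewrite avgsZ; cbv beta; rewrite ler_wpM2l ?powR_ge0// /kernel_op_mean -[leLHS]/(mean _ _).
rewrite (mean_widen m_ge2 (L := B.+1))//.
by apply: (level_comp (fun z => z `^ p)); exact: level_kop.
Qed.

(** All indices up to n are below M_(A+1), so one operator, that of level A + 1, bounds every sum of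
    partial sums and [T_mean_le_const] applies. *)
Lemma cLnorm_T_mean_le_weight A n (D : R) : (M A <= n < M A.+1)%N ->
  (weight_sum q n)^-1 * q 0%N <= D ->
  (cLnorm mu p (T n f) `^ p <= ((D * C0) `^ p * kernel_op_mean p absf A.+1)%:E)%E.
Proof.
case: n => [|n] hn hD; first by move: hn; rewrite leqNgt gen_power_gt0.
have nA : (n.+1 <= M A.+1)%N by case/andP: hn => _ /ltnW.
have D0 : 0 <= D.
  by rewrite (le_trans _ hD)// mulr_ge0 ?invr_ge0 ?ltW// weight_sum_gt0.
rewrite (@cLnorm_T_mean A.+1)// lee_fin /kernel_op_mean -[leRHS](congr1 (@^~ point) (avgsZ _ _ _ _)).
apply: avgs_le => x; rewrite -powRM ?mulr_ge0 ?kop_ge0//.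
apply: ler_powR_base; [exact: ltW|exact: normc_ge0|].
rewrite (le_trans (@T_mean_le_const _ _ _ q q_noninc q_ge0 q0_gt0 f n x (C0 * kop A.+1 x) _))//.
  by move=> l ln; apply: norm_W_le; apply: leq_trans nA.
by rewrite -[leRHS]mulrA ler_wpM2r// mulr_ge0 ?kop_ge0.
Qed.

End Weights.

End Final.

(** * The two estimates *)

Section Parts.
Context {R : realType} {m : nat -> nat} {b : nat}.
Hypothesis m_ge2 : forall k, (2 <= m k)%N.
Hypothesis m_le : forall k, (m k <= b)%N.
Local Notation X := (vilenkin m).
Local Notation M := (gen_power m).
Local Notation Mr k := ((gen_power m k)%:R : R).
Context (mu : probability X R).
Hypothesis mu_haar : is_haar mu.
Local Notation C0 := ((2 * b ^ 3)%:R : R).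

Let Mr_gt0 k : 0 < Mr k. Proof. exact: gen_powerR_gt0. Qed.

Lemma level_const_ge0 (p : R) : 0 < p -> p <= 2^-1 -> 0 <= level_const (b := b) p.
Proof.
move=> p0 p2; have p'0 : 0 < 1 - p by lra.
by rewrite /level_const !(mulr_ge0, addr_ge0)// geo_const_ge0.
Qed.

Lemma sum_kernel_op_mean_hardy (p : R) f K : 0 < p -> p <= 2^-1 -> martingale mu f ->
  ((\sum_(B < K) Mr B `^ (p - 1) * kernel_op_mean p (absf f) B.+1)%:E <=
   (level_const (b := b) p * critical_sum (m := m) p K)%:E * hardy_norm mu p f `^ p)%E.
Proof.
move=> p0 p2 mf.
have := sum_kernel_op_mean_le m_ge2 m_le p0 p2 (absf_level mf) K.
rewrite -lee_fin => /le_trans; apply.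
rewrite EFinM; apply: lee_wpmul2l; last exact: mean_max_power_le.
by rewrite lee_fin mulr_ge0 ?critical_sum_ge0 ?level_const_ge0.
Qed.

Lemma critical_sum_bounded (p : R) K : 0 < p -> p < 2^-1 ->
  critical_sum (m := m) p K <= geo_const (1 - 2 * p).
Proof.
move=> p0 p2; have r0 : 0 < 1 - 2 * p by lra.
rewrite /critical_sum (_ : 2 * p - 1 = - (1 - 2 * p)); last by ring.
rewrite -(big_mkord xpredT (fun A => Mr A `^ (- (1 - 2 * p)))).
rewrite (le_trans (sum_gen_power_first m_ge2 _ _ r0))//.
by rewrite gen_power0 powR1 mulr1.
Qed.

Lemma critical_sum_half K : critical_sum (m := m) (2^-1 : R) K = K.+1%:R.
Proof.
rewrite /critical_sum; under eq_bigr do rewrite divff ?subrr ?powRr0 ?pnatr_eq0//.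
by rewrite sumr_const card_ord.
Qed.

Section Weights.
Context (q : nat -> R) (f : nat -> X -> R[i]).
Hypotheses (q_noninc : nonincreasing_seq q) (q_ge0 : forall k, 0 <= q k) (q0_gt0 : 0 < q 0%N).
Hypothesis mf : martingale mu f.
Local Notation T := (T_mean mu q).

(** The b M_A indices of block A, each weighted by at most M_A^(2p - 2), leave M_A^(-(1 - 2p)).
    Summing this geometric series over A >= B turns M_B^(-p) into M_B^(p - 1), the weight in
    [sum_kernel_op_mean_hardy]. *)
Lemma strong_partial_sum (p : R) K : 0 < p -> p < 2^-1 ->
  (\sum_(1 <= k < M K)
      (cLnorm mu p (T k f) `^ p * ((k%:R `^ (2 - 2 * p))^-1)%:E)
   <= (b%:R * (C0 `^ p * geo_const (1 - 2 * p)) * (level_const (b := b) p * geo_const (1 - 2 * p)))%:E *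
      hardy_norm mu p f `^ p)%E.
Proof.
move=> p0 p2; have r0 : 0 < 1 - 2 * p by lra.
have g0 : 0 <= geo_const (1 - 2 * p) by apply: geo_const_ge0.
pose km B := kernel_op_mean p (absf f) B.+1.
have km0 B : 0 <= km B by apply: avgs_ge0 => x; exact: powR_ge0.
pose s A : R := \sum_(B < A.+1) Mr B `^ (- p) * km B.
have s0 A : 0 <= s A by rewrite sumr_ge0// => B _; rewrite mulr_ge0// powR_ge0.
pose r A : R := C0 `^ p * s A * (Mr A `^ (2 - 2 * p))^-1.
have rge A : 0 <= r A by rewrite /r !mulr_ge0 ?invr_ge0 ?powR_ge0.
apply: (le_trans (sum_level_blocks_le m_ge2 m_le rge _)).
  move=> A k AK hk; rewrite /r EFinM; apply: lee_pmul.
  - exact: poweR_ge0.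
  - by rewrite lee_fin invr_ge0 powR_ge0.
  - exact: (cLnorm_T_mean_le m_ge2 m_le mu_haar p0 mf q_noninc q_ge0 q0_gt0 hk).
  have /andP[Ak _] := hk; have k0 : 0 < k%:R :> R.
    by rewrite ltr0n (leq_trans _ Ak)// gen_power_gt0.
  rewrite lee_fin lef_pV2 ?posrE ?powR_gt0//.
  by apply: ler_powR_base; rewrite ?ler_nat//; lra.
apply: (@le_trans _ _ ((b%:R * (C0 `^ p * geo_const (1 - 2 * p)))%:E *
  (\sum_(B < K) Mr B `^ (p - 1) * km B)%:E)%E).
  rewrite -EFinM lee_fin -mulrA ler_wpM2l// -mulrA.
  have -> : \sum_(A < K) Mr A * r A = C0 `^ p * \sum_(A < K) \sum_(B < A.+1 + 0)
      Mr A `^ (- (1 - 2 * p)) * (Mr B `^ (- p) * km B).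
    rewrite mulr_sumr; apply: eq_bigr => A _; rewrite addn0 -mulr_sumr.
    rewrite /r -powRN -mulrA mulrCA; congr (_ * _); rewrite mulrCA mulrC; congr (_ * _).
    rewrite -{1}(powRr1 (ltW (Mr_gt0 A))) -powRD; last by rewrite (gt_eqF (Mr_gt0 A)) implybT.
    by congr (_ `^ _); ring.
  rewrite ler_wpM2l ?powR_ge0//.
  rewrite (exchange_big_triangle 0 K (fun A B => Mr A `^ (- (1 - 2 * p)) * (Mr B `^ (- p) * km B))).
  rewrite addn0 mulr_sumr.
  apply: ler_sum => B _; rewrite -mulr_suml subn0.
  rewrite (le_trans (ler_wpM2r _ (sum_gen_power_first m_ge2 _ _ r0)))//.
    by rewrite mulr_ge0 ?powR_ge0.
  rewrite -mulrA ler_wpM2l// mulrA ler_wpM2r//.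
  rewrite -powRD; last by rewrite (gt_eqF (Mr_gt0 B)) implybT.
  by rewrite (_ : - (1 - 2 * p) + - p = p - 1)//; ring.
have c0 : 0 <= b%:R * (C0 `^ p * geo_const (1 - 2 * p)) :> R by rewrite !mulr_ge0 ?powR_ge0.
have c0' : (0 <= (b%:R * (C0 `^ p * geo_const (1 - 2 * p)))%:E :> \bar R)%E by rewrite lee_fin.
apply: (le_trans (lee_wpmul2l c0' (sum_kernel_op_mean_hardy K p0 (ltW p2) mf))).
rewrite muleA -EFinM lee_wpmul2r ?poweR_ge0// lee_fin.
apply: (ler_wpM2l c0).
by rewrite ler_wpM2l ?level_const_ge0 ?(ltW p2)// critical_sum_bounded.
Qed.

(** The terms are nonnegative and N < M_N, so the partial sum up to N is bounded by the one up to
    M_N. *)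
Lemma strong_sum (p : R) : 0 < p -> p < 2^-1 ->
  (\sum_(1 <= k <oo)
      (cLnorm mu p (T k f) `^ p * ((k%:R `^ (2 - 2 * p))^-1)%:E)
   <= (b%:R * (C0 `^ p * geo_const (1 - 2 * p)) * (level_const (b := b) p * geo_const (1 - 2 * p)))%:E *
      hardy_norm mu p f `^ p)%E.
Proof.
move=> p0 p2.
have a0 k : (0 <= cLnorm mu p (T k f) `^ p * ((k%:R `^ (2 - 2 * p))^-1)%:E)%E.
  by rewrite mule_ge0 ?poweR_ge0// lee_fin invr_ge0 powR_ge0.
apply: lime_le; first by apply: is_cvg_nneseries => k _ _; exact: a0.
apply: nearW => N; apply: le_trans (strong_partial_sum N p0 p2).
have [N1|N1] := leqP 1 N; last first.
  by rewrite big_geq ?(ltnW N1)// sume_ge0// => k _; exact: a0.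
rewrite [leRHS](@big_cat_nat _ _ _ N)//=; last exact/ltnW/ltn_gen_power.
by rewrite leeDl// sume_ge0// => k _; exact: a0.
Qed.

Definition log_const (D : R) : R :=
  b%:R * (D * C0) `^ 2^-1 * level_const (b := b) 2^-1 * (3 / ln 2).

(** On block A both q_0/Q_k <= D/M_A and 1/k <= 1/M_A. The block size cancels the latter, the square
    root of the former supplies M_A^(-1/2), and the critical sum counts levels. *)
Lemma log_sum (D : R) n : 0 <= D -> (2 <= n)%N ->
  (forall k, (weight_sum q k.+1)^-1 * q 0%N <= D * k.+1%:R^-1) ->
  ((((ln n%:R)^-1)%:E *
      \sum_(1 <= k < n.+1) (cLnorm mu 2^-1 (T k f) `^ 2^-1 * (k%:R^-1)%:E))
    <= (log_const D)%:E * hardy_norm mu 2^-1 f `^ 2^-1)%E.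
Proof.
move=> D0 n2 hD; have p0 : 0 < 2^-1 :> R by rewrite invr_gt0.
pose K := (trunc_log 2 n).+1.
have nK : (n.+1 <= M K)%N.
  by rewrite (leq_trans (trunc_log_ltn n (isT : 1 < 2)%N))// exp2_le_gen_power.
pose km A := kernel_op_mean 2^-1 (absf f) A.+1.
have km0 B : 0 <= km B by apply: avgs_ge0 => x; exact: powR_ge0.
have a0 k : (0 <= cLnorm mu 2^-1 (T k f) `^ 2^-1 * (k%:R^-1)%:E)%E.
  by rewrite mule_ge0 ?poweR_ge0// lee_fin invr_ge0.
pose r A : R := (D * (Mr A)^-1 * C0) `^ 2^-1 * km A * (Mr A)^-1.
have rge A : 0 <= r A by rewrite /r mulr_ge0 ?invr_ge0// mulr_ge0 ?powR_ge0 ?km0.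
have ln2 : 0 < ln 2 :> R by rewrite ln_gt0// ltr1n.
have lnn : 0 < ln n%:R :> R by rewrite ln_gt0// ltr1n.
have S1 : (\sum_(1 <= k < n.+1) (cLnorm mu 2^-1 (T k f) `^ 2^-1 * (k%:R^-1)%:E) <=
    (b%:R * \sum_(A < K) Mr A * r A)%:E)%E.
  apply: (@le_trans _ _ (\sum_(1 <= k < M K) (cLnorm mu 2^-1 (T k f) `^ 2^-1 * (k%:R^-1)%:E))%E).
    rewrite [leRHS](@big_cat_nat _ _ _ n.+1)//=.
    by rewrite leeDl// sume_ge0// => k _; exact: a0.
  apply: (sum_level_blocks_le m_ge2 m_le rge) => A [|k] AK hk.
    by move: hk; rewrite leqNgt gen_power_gt0.
  have /andP[Ak _] := hk.
  have kA : k.+1%:R^-1 <= (Mr A)^-1 by rewrite lef_pV2 ?posrE ?ler_nat// ltr0n.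
  rewrite /r EFinM; apply: lee_pmul; rewrite ?poweR_ge0 ?lee_fin ?invr_ge0//.
  apply: (cLnorm_T_mean_le_weight m_ge2 m_le mu_haar p0 mf q_noninc q_ge0 q0_gt0 hk).
  by rewrite (le_trans (hD k))// ler_wpM2l.
have S2 : b%:R * \sum_(A < K) Mr A * r A =
    b%:R * (D * C0) `^ 2^-1 * \sum_(A < K) Mr A `^ (2^-1 - 1) * km A.
  rewrite -mulrA; congr (_ * _); rewrite mulr_sumr; apply: eq_bigr => A _.
  have -> : Mr A * r A = (D * (Mr A)^-1 * C0) `^ 2^-1 * km A.
    by rewrite /r mulrC divfK// gt_eqF.
  rewrite mulrA; congr (_ * _); rewrite mulrAC.
  rewrite [LHS]powRM ?invr_ge0 ?(mulr_ge0 D0)//; congr (_ * _).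
  rewrite -(powR_inv1 (ltW (Mr_gt0 A))) -powRrM; congr (_ `^ _); lra.
have c0' : 0 <= b%:R * (D * C0) `^ 2^-1 by rewrite mulr_ge0 ?powR_ge0.
have c0 : (0 <= (b%:R * (D * C0) `^ 2^-1)%:E :> \bar R)%E by rewrite lee_fin.
have := sum_kernel_op_mean_hardy K p0 (lexx _) mf; rewrite critical_sum_half => S3.
have S4 : (\sum_(1 <= k < n.+1) (cLnorm mu 2^-1 (T k f) `^ 2^-1 * (k%:R^-1)%:E) <=
    (b%:R * (D * C0) `^ 2^-1 * (level_const (b := b) 2^-1 * K.+1%:R))%:E * hardy_norm mu 2^-1 f `^ 2^-1)%E.
  apply: (le_trans S1); rewrite S2 EFinM.
  by apply: (le_trans (lee_wpmul2l c0 S3)); rewrite muleA -EFinM.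
have i0 : (0 <= ((ln n%:R)^-1)%:E :> \bar R)%E by rewrite lee_fin invr_ge0 ltW.
apply: (le_trans (lee_wpmul2l i0 S4)).
rewrite muleA -EFinM lee_wpmul2r ?poweR_ge0// lee_fin /log_const.
rewrite -[leRHS]mulrA mulrCA; apply: (ler_wpM2l c0').
rewrite mulrCA ler_wpM2l ?level_const_ge0// mulrC ler_pdivrMr// mulrAC ler_pdivlMr//.
have h1 : (trunc_log 2 n)%:R * ln 2 <= ln n%:R :> R.
  rewrite mulr_natl -lnXn// ler_ln ?posrE ?exprn_gt0 ?ltr0n ?(ltnW n2)//.
  by rewrite -natrX ler_nat trunc_logP// ltnW.
have h2 : ln 2 <= ln n%:R :> R by rewrite ler_ln ?posrE ?ltr0n ?ler_nat// ltnW.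
(* K + 1 is the truncated binary logarithm of n plus 2; as n >= 2, this is at most 3 ln n / ln 2,
   whence the factor in [log_const]. *)
rewrite /K -addn2 natrD; lra.
Qed.

End Weights.
End Parts.

Theorem theorem3 (R : realType) (m : nat -> nat)
    (m_ge2 : forall k, (2 <= m k)%N)
    (m_bounded : exists B : nat, forall k, (m k <= B)%N)
    (mu : probability (vilenkin m) R) (mu_haar : is_haar mu) :
  (forall p : R, 0 < p -> p < 2^-1 ->
   exists c : R,
   forall q : nat -> R, nonincreasing_seq q -> (forall k, 0 <= q k) ->
     0 < q 0%N ->
   forall f : nat -> vilenkin m -> complex R, hardy mu p f ->
     (\sum_(1 <= k <oo)
        (cLnorm mu p (T_mean mu q k f) `^ p * ((k%:R `^ (2 - 2 * p))^-1)%:E)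
      <= c%:E * hardy_norm mu p f `^ p)%E)
  /\
  (forall q0 C : R, exists c : R,
   forall q : nat -> R, nonincreasing_seq q -> (forall k, 0 <= q k) ->
     0 < q 0%N -> q 0%N = q0 ->
     (\forall n \near \oo, `|(weight_sum q n)^-1| <= C * `|n%:R^-1|) ->
   forall f : nat -> vilenkin m -> complex R, hardy mu 2^-1 f ->
   forall n : nat, (2 <= n)%N ->
     (((ln n%:R)^-1)%:E *
        \sum_(1 <= k < n.+1)
          (cLnorm mu 2^-1 (T_mean mu q k f) `^ 2^-1 * (k%:R^-1)%:E)
      <= c%:E * hardy_norm mu 2^-1 f `^ 2^-1)%E).
Proof.
have [b m_le] := m_bounded; split.
  (* The constant supplied by [strong_sum] involves only p and the bound b on m. *)
  move=> p p0 p2; eexists => q qd q0 q00 f [mf _].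
  exact: (strong_sum m_ge2 m_le mu_haar qd q0 q00 mf).
(* [weight_sumV_le] gives q_0/Q_k <= C q_0/k. The constant is fixed before [q] is given, so the
   absolute value secures its sign. *)
move=> q0 C; exists (log_const (b := b) (`|C * q0|)) => q qd qge qgt q0E qC f [mf _] n n2.
apply: (log_sum m_ge2 m_le mu_haar qd qge qgt mf) => // k.
rewrite (le_trans (ler_wpM2r (ltW qgt) (weight_sumV_le qd qge qgt k qC)))// q0E.
by rewrite mulrAC ler_wpM2r ?invr_ge0 ?ler_norm.
Qed.
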